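(* Let $d\ge 3$ be an integer, let $K\in\{\mathbb{R},\mathbb{C}\}$, and let $V_1,\ldots,V_d$ and $V$ be finite-dimensional inner product spaces over $K$. Regard $V_1\otimes\cdots\otimes V_d$, $\mathrm{Sym}_d(V)$ and $\mathrm{Alt}_d(V)$ as real vector spaces. Then the following sets are real algebraic varieties, i.e. each is the set of common zeros of a set of real polynomial functions on the ambient real vector space, and these defining polynomials can be chosen with the following degrees. (1) Symmetric case. If $K=\mathbb{R}$, the set of symmetrically odeco tensors in $\mathrm{Sym}_d(V)$ is defined by polynomials of degree $2$. If $K=\mathbb{C}$, the set of symmetrically udeco tensors in $\mathrm{Sym}_d(V)$ is defined by polynomials of degree $3$. (2) Ordinary case. If $K=\mathbb{R}$, the set of odeco tensors in $V_1\otimes\cdots\otimes V_d$ is defined by polynomials of degree $2$. If $K=\mathbb{C}$, the set of udeco tensors in $V_1\otimes\cdots\otimes V_d$ is defined by polynomials of degree $3$. (3) Alternating case. If $K=\mathbb{R}$, the set of alternatingly odeco tensors in $\mathrm{Alt}_d(V)$ is defined by polynomials of degrees $2$ and $4$. If $K=\mathbb{C}$, the set of alternatingly udeco tensors in $\mathrm{Alt}_d(V)$ is defined by polynomials of degrees $3$ and $4$.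
   Context: Let $K\in\{\mathbb{R},\mathbb{C}\}$. All inner products are positive-definite, and Hermitian if $K=\mathbb{C}$; tensor products are over $K$. For $K=\mathbb{C}$ the complex tensor spaces are regarded as real vector spaces, so that real polynomial functions are polynomials in the coordinates with respect to a $\mathbb{C}$-basis and their complex conjugates (real and imaginary parts). The set of defining polynomials is allowed to be empty. A tensor in $V_1\otimes\cdots\otimes V_d$ is called odeco (if $K=\mathbb{R}$) or udeco (if $K=\mathbb{C}$) if it can be written as $\sum_{i=1}^k v_{i1}\otimes\cdots\otimes v_{id}$ (with $k\ge 0$), where for each $j$ the vectors $v_{1j},\ldots,v_{kj}$ are nonzero and pairwise orthogonal in $V_j$. $\mathrm{Sym}_d(V)\subseteq V^{\otimes d}$ is the subspace of tensors fixed by all permutations of the tensor factors. A tensor in $\mathrm{Sym}_d(V)$ is called symmetrically odeco (if $K=\mathbb{R}$) or symmetrically udeco (if $K=\mathbb{C}$) if it can be written as $\sum_{i=1}^k \pm v_i^{\otimes d}$ (with $k\ge0$), where $v_1,\ldots,v_k\in V$ are nonzero and pairwise orthogonal. $\mathrm{Alt}_d(V)\subseteq V^{\otimes d}$ is the subspace of tensors $T$ with $\pi T=\mathrm{sgn}(\pi)T$ for every permutation $\pi$ of the $d$ tensor factors, and $v_1\wedge\cdots\wedge v_d:=\sum_{\pi\in S_d}\mathrm{sgn}(\pi)\,v_{\pi(1)}\otimes\cdots\otimes v_{\pi(d)}$. A tensor in $\mathrm{Alt}_d(V)$ is called alternatingly odeco (if $K=\mathbb{R}$) or alternatingly udeco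 (if $K=\mathbb{C}$) if it can be written as $\sum_{i=1}^k v_{i1}\wedge\cdots\wedge v_{id}$ (with $k\ge0$), where the $k\cdot d$ vectors $v_{11},\ldots,v_{kd}\in V$ are nonzero and pairwise orthogonal. *)

(* Defs.v *)
(* R : realType is the field of real numbers, R[i] the field of
   complex numbers. *)
From HB Require Import structures.
From mathcomp Require Import all_boot all_order all_fingroup all_algebra.
From mathcomp Require Import sesquilinear complex mpoly reals.

Set Implicit Arguments.
Unset Strict Implicit.
Unset Printing Implicit Defensive.

Import Order.TTheory GRing.Theory Num.Theory.
Local Open Scope ring_scope.

Section Tensors.
Variables (K : fieldType) (d : nat).

(* The library has no tensor products.  As a model of V_1 (x) ... (x) V_d we take
   the coordinate arrays with respect to the products of the vectors of the
   bases vbasis {:V j}; [tens] is the universal multilinear map.  That this is a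
   tensor product is the content of [tens_multilinear] and [tens_basis]: a
   multilinear map sending the products of basis vectors to a basis. *)
Definition tindex (V : 'I_d -> vectType K) : finType :=
  {dffun forall j : 'I_d, 'I_(\dim {:V j})}.

Definition tensor (V : 'I_d -> vectType K) : vectType K :=
  {ffun tindex V -> K^o}.

Definition tens (V : 'I_d -> vectType K) (v : forall j, V j) : tensor V :=
  [ffun i : tindex V => \prod_(j < d) coord (vbasis {:V j}) (i j) (v j)].

Lemma tens_multilinear (V : 'I_d -> vectType K) (v : forall j, V j) (j : 'I_d)
    (a : K) (x y : V j) :
  tens (dfwith v (a *: x + y)) = a *: tens (dfwith v x) + tens (dfwith v y).
Proof.
apply/ffunP => i; rewrite !ffunE.
have e z : \prod_(l < d) coord (vbasis {:V l}) (i l) (dfwith v z l) =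
    coord (vbasis {:V j}) (i j) z *
    \prod_(l < d | l != j) coord (vbasis {:V l}) (i l) (v l).
  rewrite (bigD1 j) //= dfwith_in; congr (_ * _).
  by apply: eq_bigr => l lj; rewrite dfwith_out // eq_sym.
by rewrite !e linearP mulrDl -mulrA.
Qed.

Lemma tens_basis (V : 'I_d -> vectType K) (i : tindex V) :
  tens (fun j => (vbasis {:V j})`_(i j)) = [ffun i' : tindex V => (i' == i)%:R].
Proof.
apply/ffunP => i'; rewrite !ffunE.
under eq_bigr => j _ do
  rewrite coord_free ?(basis_free (vbasisP _)) // [i _ == _]eq_sym.
case: (eqVneq i' i) => [->|ne]; first by rewrite big1 // => j _; rewrite eqxx.
have /existsP[j ne_j] : [exists j, i' j != i j].
  apply: contraNT ne; rewrite negb_exists => /forallP e.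
  by apply/eqP/ffunP => j; apply/eqP; have := e j; rewrite negbK.
by rewrite (bigD1 j) //= (negPf ne_j) mul0r.
Qed.

Variable V : vectType K.

(* V^{(x) d}. *)
Definition tpower : vectType K := tensor (fun _ : 'I_d => V).

(* The permutation s moves the tensor factor in position j to position s j,
   cf. [tpermute_tens]. *)
Definition tpermute (s : 'S_d) (T : tpower) : tpower :=
  [ffun i : tindex (fun _ : 'I_d => V) => T [ffun j => i (s j)]].

Lemma tpermute_tens (s : 'S_d) (v : 'I_d -> V) :
  tpermute s (tens v) = tens (fun j => v ((s^-1)%g j)).
Proof.
apply/ffunP => i; rewrite !ffunE (reindex_inj (@perm_inj _ s^-1%g)) /=.
by apply: eq_bigr => j _; rewrite ffunE permKV.
Qed.

Fact tpermute_linear (s : 'S_d) : linear (tpermute s).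
Proof. by move=> a x y; apply/ffunP => i; rewrite !ffunE. Qed.

HB.instance Definition _ (s : 'S_d) :=
  GRing.isLinear.Build K tpower tpower *:%R (tpermute s) (tpermute_linear s).

Definition Sym : {vspace tpower} :=
  (\bigcap_(s : 'S_d) fixedSpace (linfun (tpermute s)))%VS.

Definition Alt : {vspace tpower} :=
  (\bigcap_(s : 'S_d) lker (linfun (tpermute s) - (-1) ^+ s *: \1%VF))%VS.

Lemma SymP (T : tpower) :
  reflect (forall s : 'S_d, tpermute s T = T) (T \in Sym).
Proof.
rewrite memvE; apply: (iffP subv_bigcapP) => h s => [|_]; last first.
  by rewrite -memvE; apply/fixedSpaceP; rewrite lfunE /= h.
by have := h s isT; rewrite -memvE => /fixedSpaceP; rewrite lfunE.
Qed.

Lemma AltP (T : tpower) :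
  reflect (forall s : 'S_d, tpermute s T = (-1) ^+ s *: T) (T \in Alt).
Proof.
rewrite memvE; apply: (iffP subv_bigcapP) => h s => [|_]; last first.
  by rewrite -memvE memv_ker !lfun_simp /= h subrr.
have := h s isT; rewrite -memvE memv_ker !lfun_simp /= subr_eq0.
by move/eqP.
Qed.

Definition wedge (v : 'I_d -> V) : tpower :=
  \sum_(s : 'S_d) (-1) ^+ s *: tens (fun j => v (s j)).

End Tensors.

(* In this section theta is idfun for K = R and complex conjugation for
   K = R[i]; {dot V for theta} is the type of positive definite symmetric,
   respectively Hermitian, forms on V. *)
Section Decomposable.
Variables (K : numFieldType) (theta : K -> K).

Definition orthogonal_family (I : eqType) (V : vectType K)
    (ip : {dot V for theta}) (v : I -> V) : Prop :=
  (forall i, v i != 0) /\ (forall i j, i != j -> ip (v i) (v j) = 0).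

(* odeco for K = R, udeco for K = R[i] *)
Definition deco (d : nat) (V : 'I_d -> vectType K)
    (ip : forall j, {dot (V j) for theta}) (T : tensor V) : Prop :=
  exists (k : nat) (v : 'I_k -> forall j, V j),
    (forall j, orthogonal_family (ip j) (fun i => v i j)) /\
    T = \sum_(i < k) tens (v i).

Definition sym_deco (d : nat) (V : vectType K) (ip : {dot V for theta})
    (T : subvs_of (Sym d V)) : Prop :=
  exists (k : nat) (eps : 'I_k -> bool) (v : 'I_k -> V),
    orthogonal_family ip v /\
    vsval T = \sum_(i < k) (-1) ^+ eps i *: tens (fun _ : 'I_d => v i).

Definition alt_deco (d : nat) (V : vectType K) (ip : {dot V for theta})
    (T : subvs_of (Alt d V)) : Prop :=
  exists (k : nat) (v : 'I_k -> 'I_d -> V),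
    orthogonal_family ip (fun a : 'I_k * 'I_d => v a.1 a.2) /\
    vsval T = \sum_(i < k) wedge (v i).

End Decomposable.

Section RealVarieties.
Variable R : realType.

(* Real coordinates on a finite-dimensional vector space over R, respectively
   over R[i] regarded as a real vector space. *)
Definition rcoords (W : vectType R) (w : W) : 'I_(\dim {:W}) -> R :=
  fun j => coord (vbasis {:W}) j w.

Definition ccoords (W : vectType R[i]) (w : W) :
    'I_(\dim {:W} + \dim {:W}) -> R :=
  fun l => match split l with
           | inl j => complex.Re (coord (vbasis {:W}) j w)
           | inr j => complex.Im (coord (vbasis {:W}) j w)
           end.

(* X is the set of common zeros of a (possibly empty or infinite) set of real
   polynomials in the coordinates x, each of total degree exactly e for some e
   in degs; recall that msize is the degree plus one, and 0 for the zero
   polynomial. *)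
Definition defined_in_degrees (W : Type) (n : nat) (x : W -> 'I_n -> R)
    (degs : seq nat) (X : W -> Prop) : Prop :=
  exists P : {mpoly R[n]} -> Prop,
    (forall p, P p -> exists2 e, e \in degs & msize p = e.+1) /\
    (forall w, X w <-> forall p, P p -> p.@[x w] = 0).

Definition real_variety (W : vectType R) (degs : seq nat) (X : W -> Prop) :=
  defined_in_degrees (@rcoords W) degs X.

Definition complex_variety (W : vectType R[i]) (degs : seq nat)
    (X : W -> Prop) :=
  defined_in_degrees (@ccoords W) degs X.

End RealVarieties.

(* Main.v *)
(* Contraction with vectors turns T into a multilinear form f, and T is decomposable
   iff f(x) is a sum of products <x_1,v_i1>...<x_d,v_id> with orthogonal v_ij.

   Ordinary and symmetric case.  Two slots 0 and l and a filling u of the others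
   give a semilinear map A_u between V_0 and V_l.  On decomposable tensors
   A_u A_w^* A_v = A_v A_w^* A_u (for K = R even A_u A_w^* and A_u^* A_w are
   self-adjoint, which is quadratic and implies the cubic identity).  Conversely
   the identity makes the operators A_u^* A_w on V_0 a commuting family, closed
   under adjoints, and the contractions of T with an orthonormal basis of common
   eigenvectors are pure tensors, orthogonal in each slot.

   Alternating case.  Let (R_{z,w} u | v) be the inner product of f(z,u,...) and
   f(w,v,...), and F(z,w;u) the value at u of the derivation of f by R_{z,w}.  On a
   block of dimension d the trace makes F(z,w;u) a multiple of <z,w> f(u), so
   all operators F_u (of degree 3 in T) lie in the centroid
   {A : f(A x_1, x_2, ...) = f(x_1, A x_2, ...) = ...}, which is a condition of degree 4.
   The centroid is commutative since d >= 3, so the F_u have an orthonormal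
   eigenbasis, and f splits along the joint eigenspaces.  A cubic identity
   expressing f(R_{z,w} x_1, x_2, ...) through F forces Cramer's rule on each
   eigenspace on which f is nonzero, whose dimension is therefore d. *)
Require Import Defs.
From HB Require Import structures.
From mathcomp Require Import all_boot all_order all_fingroup all_algebra.
From mathcomp Require Import sesquilinear complex mpoly boolp reals ring spectral.

Set Implicit Arguments.
Unset Strict Implicit.
Unset Printing Implicit Defensive.

Import Order.TTheory GRing.Theory Num.Theory.
Local Open Scope ring_scope.

(** * Inner products and commuting operators *)

(* The only facts about (R, idfun) and (R[i], conjugation) that are used. *)
Record scalar_field (K : numFieldType) (theta : {rmorphism K -> K}) : Prop :=
  ScalarField {
    conjgK : involutive theta;
    mulconj_ge0 : forall a, 0 <= a * theta a;
    ex_mulconj : forall a, 0 <= a -> exists b, a = b * theta b;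
    ex_eigenvector : forall (V : vectType K) (ip : {dot V for theta})
        (A : 'End(V)) (D : {vspace V}),
      (A @: D <= D)%VS -> D != 0%VS ->
      (theta =1 id -> forall x y, ip (A x) y = ip x (A y)) ->
      exists x, [/\ x \in D, x != 0 & exists l, A x = l *: x] }.

Section InnerProduct.
Variables (K : numFieldType) (theta : {rmorphism K -> K}).
Hypothesis KP : scalar_field theta.
Variables (V : vectType K) (ip : {dot V for theta}).

Lemma ipC x y : ip x y = theta (ip y x).
Proof. by have := @hermC K false theta V ip x y; rewrite expr0 mul1r. Qed.

Lemma ipDl x y z : ip (x + y) z = ip x z + ip y z.
Proof. exact: linearDl. Qed.
Lemma ipZl a x z : ip (a *: x) z = a * ip x z.
Proof. exact: (@linearZl_LR _ _ _ _ _ _ ip). Qed.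
Lemma ipDr x y z : ip x (y + z) = ip x y + ip x z.
Proof. exact: linearDr. Qed.
Lemma ipZr a x z : ip x (a *: z) = theta a * ip x z.
Proof. exact: (@linearZr_LR _ _ _ _ _ _ ip). Qed.
Lemma ip0l x : ip 0 x = 0. Proof. exact: linear0l. Qed.
Lemma ip0r x : ip x 0 = 0. Proof. exact: linear0r. Qed.
Lemma ipBl x y z : ip (x - y) z = ip x z - ip y z.
Proof. exact: linearBl. Qed.
Lemma ip_suml I r (P : pred I) (F : I -> V) z :
  ip (\sum_(i <- r | P i) F i) z = \sum_(i <- r | P i) ip (F i) z.
Proof. exact: linear_sumlz. Qed.
Lemma ip_sumr I r (P : pred I) (F : I -> V) z :
  ip z (\sum_(i <- r | P i) F i) = \sum_(i <- r | P i) ip z (F i).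
Proof. exact: linear_sumr. Qed.
Lemma ip_gt0 x : x != 0 -> 0 < ip x x.
Proof. exact: neq0_dnorm_gt0. Qed.
Lemma ip_eq0 x : (ip x x == 0) = (x == 0).
Proof.
by case: (eqVneq x 0) => [->|/ip_gt0/gt_eqF//]; rewrite ip0l eqxx.
Qed.

Lemma ip_ge0 x : 0 <= ip x x.
Proof. by case: (eqVneq x 0) => [->|/ip_gt0/ltW//]; rewrite ip0l. Qed.
Definition orthonormal_basis n (e : 'I_n -> V) :=
  (forall i j, ip (e i) (e j) = (i == j)%:R) /\
  (forall x, x = \sum_i ip x (e i) *: e i).

Lemma ip_ext x y : (forall z, ip x z = ip y z) -> x = y.
Proof.
move=> h; apply/eqP; rewrite -subr_eq0 -ip_eq0 ipBl h subrr //.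
Qed.

Lemma parseval n (e : 'I_n -> V) x y : orthonormal_basis e ->
  ip x y = \sum_i ip x (e i) * theta (ip y (e i)).
Proof.
case=> _ he; rewrite {1}[x]he ip_suml; apply: eq_bigr => i _.
by rewrite ipZl [ip (e i) y]ipC.
Qed.

(** * Orthonormal bases of common eigenvectors *)

Section Spectral.
Variables (I : Type) (A : I -> 'End(V)).
Hypothesis A_adj : forall i, exists j, forall x y, ip (A i x) y = ip x (A j y).
Hypothesis A_com : forall i j x, A i (A j x) = A j (A i x).
Hypothesis A_sa :
  theta =1 id -> forall i x y, ip (A i x) y = ip x (A i y).

(** Induction on the dimension. If some vector of [D] is not an eigenvector of some [A i], an
    eigenspace of [A i] in [D] is nonzero and proper, and it is invariant under the whole family
    because the operators commute. *)
Lemma common_eigenvector (D : {vspace V}) :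
  (forall i, A i @: D <= D)%VS -> D != 0%VS ->
  exists2 x, x \in D & x != 0 /\ forall i, exists l, A i x = l *: x.
Proof.
have [n] := ubnP (\dim D); elim: n D => // n IHn D dimD AD D0.
case: (pselect (forall i x, x \in D -> exists l, A i x = l *: x)) => [h|].
  exists (vpick D); first exact: memv_pick.
  by rewrite vpick0; split=> // i; apply/h/memv_pick.
move=> /existsNP[i /existsNP[x /not_implyP[xD nx]]].
have [z [zD z0 [l lz]]] := ex_eigenvector KP (AD i) D0 (fun h => A_sa h i).
pose D' := (D :&: lker (A i - l *: \1%VF))%VS.
have D'P u : (u \in D') = (u \in D) && (A i u == l *: u).
  by rewrite memv_cap memv_ker !lfun_simp subr_eq0.
have sD' : (D' <= D)%VS := capvSl _ _.
case: (IHn D') => [||| u uD' hu].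
- rewrite (leq_trans _ (dimD : _ <= n)%N) // ltn_neqAle dimvS // andbT.
  apply/eqP => e; apply: nx; exists l; apply/eqP.
  have: x \in D' by rewrite (_ : D' = D) //; apply/eqP; rewrite eqEdim sD' e /=.
  by rewrite D'P => /andP[].
- move=> j; apply/subvP => _ /memv_imgP[u + ->].
  rewrite D'P => /andP[uD /eqP hu]; rewrite D'P A_com hu linearZ eqxx andbT.
  by apply: (subvP (AD j)); apply: memv_img.
- by apply: contraNneq z0 => e; rewrite -memv0 -e D'P zD lz eqxx.
- by exists u; first exact: (subvP sD').
Qed.

(** A common unit eigenvector is split off. Its orthogonal complement stays invariant, since the
    adjoint of each [A i] is again in the family and has the same eigenvector. *)
Lemma spectral_basis :
  exists n (e : 'I_n -> V), orthonormal_basis e /\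
    forall i k, exists l, A i (e k) = l *: e k.
Proof.
(* Generalised to invariant subspaces, so that induction on the dimension applies. *)
suff [n [e [eo ee _ es]]] : exists n (e : 'I_n -> V),
  [/\ (forall i j, ip (e i) (e j) = (i == j)%:R),
      (forall i k, exists l, A i (e k) = l *: e k),
      (forall k, e k \in fullv) &
      (forall x, x \in fullv -> x = \sum_i ip x (e i) *: e i)].
  by exists n, e; split=> //; split=> // x; apply/es/memvf.
have : (forall i, A i @: fullv <= fullv)%VS by move=> i; apply: subvf.
move: fullv => D; have [n] := ubnP (\dim D).
elim: n D => // n IHn D dimD AD.
case: (eqVneq D 0%VS) => [->|D0].
  exists 0, (fun _ => 0); split; [by case | by move=> ? [] | by case |].
  by move=> x; rewrite memv0 => /eqP ->; rewrite big_ord0.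
have [x0 x0D [nx0 ex0]] := common_eigenvector AD D0.
(* The factor [b] serves as the norm of [x0] in the normalisation. *)
have [b hb] := ex_mulconj KP (ip_ge0 x0).
have b0 : b != 0.
  by apply: contraTneq nx0 => b0; rewrite negbK -ip_eq0 hb b0 mul0r.
pose x := b^-1 *: x0.
have xD : x \in D by rewrite memvZ.
have xx : ip x x = 1.
  by rewrite ipZl ipZr hb fmorphV mulrCA mulKf // mulVf ?fmorph_eq0.
have ex i : exists l, A i x = l *: x.
  by have [l hl] := ex0 i; exists l; rewrite linearZ /= hl !scalerA mulrC.
have x0' : x != 0 by rewrite -ip_eq0 xx oner_eq0.
pose D' := (D :&: orthov ip <[x]>)%VS.
have D'P u : (u \in D') = (u \in D) && (ip u x == 0).
  by rewrite memv_cap mem_orthov1.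
case: (IHn D') => [||m [e [eo ee eD es]]].
- rewrite (leq_trans _ (dimD : _ <= n)%N) // ltn_neqAle dimvS ?capvSl // andbT.
  apply/eqP => e; have: x \in D'.
    by rewrite (_ : D' = D) //; apply/eqP; rewrite eqEdim capvSl e /=.
  by rewrite D'P xx oner_eq0 andbF.
- move=> i; apply/subvP => _ /memv_imgP[u + ->].
  rewrite !D'P => /andP[uD /eqP hu].
  rewrite (subvP (AD i)) ?memv_img //=.
  by have [j ->] := A_adj i; have [l ->] := ex j; rewrite ipZr hu mulr0.
have exo k : ip (e k) x = 0 by have := eD k; rewrite D'P => /andP[_ /eqP].
exists m.+1, (fun i => if unlift ord0 i is Some k then e k else x); split.
- move=> i j; case: (unliftP ord0 i) => [i'|] ->; case: (unliftP ord0 j) => [j'|] ->.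
  + by rewrite eo (inj_eq lift_inj).
  + by rewrite exo.
  + by rewrite ipC exo rmorph0.
  + by rewrite xx eqxx.
- by move=> i k; case: (unliftP ord0 k) => [k'|] _.
- move=> k; case: (unliftP ord0 k) => [k'|] _ //.
  by have := eD k'; rewrite D'P => /andP[].
- move=> u uD; rewrite big_ord_recl unlift_none.
  have vD : u - ip u x *: x \in D'.
    by rewrite D'P memvB ?memvZ //= ipBl ipZl xx mulr1 subrr.
  rewrite -[LHS](subrK (ip u x *: x)) addrC {1}(es _ vD); congr (_ + _).
  apply: eq_bigr => i _; rewrite liftK ipBl ipZl [ip x _]ipC exo.
  by rewrite rmorph0 mulr0 subr0.
Qed.

End Spectral.

Lemma ex_orthonormal_basis : exists n (e : 'I_n -> V), orthonormal_basis e.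
Proof.
have := @spectral_basis void (fun _ => \1%VF).
by case=> // n [e [he _]]; exists n, e.
Qed.

Definition onb_size : nat := sval (cid ex_orthonormal_basis).
Definition onb : 'I_onb_size -> V := sval (cid (svalP (cid ex_orthonormal_basis))).
Lemma onbP : orthonormal_basis onb.
Proof. exact: svalP (cid (svalP (cid ex_orthonormal_basis))). Qed.

(** The Riesz representative of [g]; the conjugates compensate for the semilinearity of [ip] in its
    second argument. *)
Definition riesz (g : V -> K) : V := \sum_i theta (g (onb i)) *: onb i.

Lemma rieszP (g : V -> K) x : scalar g ->
  ip x (riesz g) = g x.
Proof.
move=> gl; have g0 : g 0 = 0.
  by have := gl (-1) 0 0; rewrite scaler0 addr0 mulN1r addNr.
have gs r (c : 'I_onb_size -> K) :
    g (\sum_(i <- r) c i *: onb i) = \sum_(i <- r) c i * g (onb i).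
  by elim: r => [|i r IH]; rewrite ?big_nil ?big_cons // gl IH.
case: onbP => _ he; rewrite {2}[x]he gs ip_sumr.
by apply: eq_bigr => i _; rewrite ipZr (conjgK KP) mulrC.
Qed.

End InnerProduct.

Arguments onb {K theta} KP {V} ip _.

Lemma ex_lfun (K : fieldType) (V W : vectType K) (g : V -> W) :
  (forall a x y, g (a *: x + y) = a *: g x + g y) ->
  exists A : 'Hom(V, W), forall x, A x = g x.
Proof.
move=> gl; pose G : {linear V -> W} :=
  HB.pack g (GRing.isLinear.Build K V W *:%R g gl).
by exists (linfun G) => x; rewrite lfunE.
Qed.

(** * Multilinear forms *)

Section Update.
Variables (d : nat) (V : 'I_d -> Type).
Implicit Types (x : forall j, V j).

Definition upd x j (y : V j) : forall k, V k := dfwith x y.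

Lemma upd_same x j (y : V j) : upd x y j = y.
Proof. exact: dfwith_in. Qed.

Lemma upd_neq x j (y : V j) k : k != j -> upd x y k = x k.
Proof. by move=> kj; apply: dfwith_out; rewrite eq_sym. Qed.

Lemma upd_id x j : upd x (x j) = x.
Proof.
apply: functional_extensionality_dep => k.
by case: (eqVneq k j) => [->|kj]; rewrite ?upd_same ?upd_neq.
Qed.

Lemma upd_upd x j (y z : V j) : upd (upd x y) z = upd x z.
Proof.
apply: functional_extensionality_dep => k.
by case: (eqVneq k j) => [->|kj]; rewrite ?upd_same ?upd_neq.
Qed.

Lemma updC x j k (y : V j) (z : V k) : j != k ->
  upd (upd x y) z = upd (upd x z) y.
Proof.
move=> jk; apply: functional_extensionality_dep => l.
case: (eqVneq l k) => [->|lk]; first by rewrite upd_same upd_neq ?upd_same // eq_sym.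
rewrite (upd_neq _ _ lk); case: (eqVneq l j) => [->|lj]; first by rewrite !upd_same.
by rewrite !upd_neq.
Qed.

End Update.

Section Multilinear.
Variables (K : fieldType) (d : nat) (V : 'I_d -> vectType K).
Implicit Types (f g : (forall j, V j) -> K) (x : forall j, V j).

Definition multilinear f :=
  forall x (j : 'I_d), scalar (fun y : V j => f (upd x y)).

Lemma multilinearD f x j (y z : V j) : multilinear f ->
  f (upd x (y + z)) = f (upd x y) + f (upd x z).
Proof. by move=> fl; have := fl x j 1 y z; rewrite scale1r mul1r. Qed.

Lemma multilinear0 f x (j : 'I_d) : multilinear f -> f (upd x (0 : V j)) = 0.
Proof.
move=> fl; have := fl x j (-1) 0 0; rewrite /= scaler0 addr0 mulN1r addNr //.
Qed.

Lemma multilinearZ f x j a (y : V j) : multilinear f ->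
  f (upd x (a *: y)) = a * f (upd x y).
Proof.
by move=> fl; have := fl x j a y 0; rewrite /= multilinear0 // !addr0.
Qed.

Lemma multilinearB f x j (y z : V j) : multilinear f ->
  f (upd x (y - z)) = f (upd x y) - f (upd x z).
Proof. by move=> fl; rewrite multilinearD // -scaleN1r multilinearZ // mulN1r. Qed.

Lemma multilinear_sum f x j I r (P : pred I) (F : I -> V j) : multilinear f ->
  f (upd x (\sum_(i <- r | P i) F i)) = \sum_(i <- r | P i) f (upd x (F i)).
Proof.
move=> fl; apply: (big_morph (fun y => f (upd x y))) => [y z|].
  exact: multilinearD.
exact: multilinear0.
Qed.

Lemma multilinear_lc f g a : multilinear f -> multilinear g ->
  multilinear (fun x => f x - a * g x).
Proof.
by move=> fl gl x j b y z /=; rewrite fl gl mulrBr mulrDr opprD addrACA mulrCA.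
Qed.

Lemma multilinear_prod (phi : forall j, V j -> K) :
  (forall j, scalar (phi j)) -> multilinear (fun x => \prod_j phi j (x j)).
Proof.
move=> phil x j b y z /=.
have e u : \prod_k phi k (upd x u k) = phi j u * \prod_(k | k != j) phi k (x k).
  rewrite (bigD1 j) //= upd_same; congr (_ * _).
  by apply: eq_bigr => k kj; rewrite upd_neq.
by rewrite !e phil mulrDl mulrA.
Qed.

Lemma multilinear_bigsum I r (P : pred I) (F : I -> (forall j, V j) -> K) :
  (forall i, multilinear (F i)) ->
  multilinear (fun x => \sum_(i <- r | P i) F i x).
Proof.
move=> Fl x j b y z /=; rewrite mulr_sumr -big_split /=.
by apply: eq_bigr => i _; rewrite Fl.
Qed.

Lemma multilinear_scale f a : multilinear f -> multilinear (fun x => a * f x).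
Proof. by move=> fl x j b y z /=; rewrite fl mulrDr mulrCA. Qed.

(** The first hypothesis says that [S j] spans [V j]. The slots are freed one at a time: at stage
    [n] the first [n] entries are arbitrary. *)
Lemma multilinear_vanish (S : forall j, V j -> Prop) f :
  (forall j (g : V j -> K), scalar g -> (forall v, S j v -> g v = 0) ->
     forall v, g v = 0) ->
  multilinear f -> (forall x, (forall j, S j (x j)) -> f x = 0) ->
  forall x, f x = 0.
Proof.
move=> hS fl f0.
suff h n : (n <= d)%N -> forall x, (forall j : 'I_d, n <= j -> S j (x j))%N -> f x = 0.
  by move=> x; apply: (h d (leqnn d)) => j; rewrite leqNgt ltn_ord.
elim: n => [|n IHn] nd x hx; first by apply: f0 => j; apply: hx.
pose j := Ordinal nd; rewrite -(upd_id x j).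
apply: (hS j (fun y => f (upd x y))) => [|v Sv]; first exact: fl.
apply: (IHn (ltnW nd)) => k nk; case: (eqVneq k j) => [->|kj].
  by rewrite upd_same.
rewrite upd_neq //; apply: hx; rewrite ltn_neqAle nk andbT.
by apply: contra kj => /eqP e; apply/eqP/val_inj.
Qed.

End Multilinear.

Section MultilinearInner.
Variables (K : numFieldType) (theta : {rmorphism K -> K}).
Hypothesis KP : scalar_field theta.
Variables (d : nat) (V : 'I_d -> vectType K) (ip : forall j, {dot (V j) for theta}).
Implicit Types (f g : (forall j, V j) -> K) (x : forall j, V j).

Lemma ip_scalar (W : vectType K) (ipW : {dot W for theta}) (v : W) :
  scalar (fun y => ipW y v).
Proof. by move=> a y z /=; rewrite ipDl ipZl. Qed.

(** Each [V j] is spanned by [q j] and its orthogonal complement. On tuples drawn from these, both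
    sides vanish if some entry is orthogonal to [q j], and the constant is chosen to fit at the
    remaining tuple [q]. *)
Lemma multilinear_pure f q : multilinear f ->
  (forall j, q j != 0) ->
  (forall x j, ip j (x j) (q j) = 0 -> f x = 0) ->
  forall x, f x = f q / (\prod_j ip j (q j) (q j)) * \prod_j ip j (x j) (q j).
Proof.
move=> fl q0 fq x; apply/eqP; rewrite -subr_eq0; apply/eqP; move: x.
have pl : multilinear (fun x => \prod_j ip j (x j) (q j)).
  exact: (multilinear_prod (fun j => @ip_scalar _ (ip j) (q j))).
apply: (@multilinear_vanish _ _ _ (fun j v => v = q j \/ ip j v (q j) = 0)).
- move=> j g gl g0 v.
  have -> : v = (ip j v (q j) / ip j (q j) (q j)) *: q j +
                 (v - (ip j v (q j) / ip j (q j) (q j)) *: q j).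
    by rewrite addrC subrK.
  rewrite gl g0 ?mulr0 ?add0r; last by left.
  by apply: g0; right; rewrite ipBl ipZl mulfVK ?subrr // ip_eq0 q0.
- exact: multilinear_lc.
move=> x hx; case: (pselect (exists j, ip j (x j) (q j) = 0)) => [[j xj]|nx].
  by rewrite (fq x j) // [X in _ * X](bigD1 j) //= xj mul0r !mulr0 subrr.
have -> : x = q.
  apply: functional_extensionality_dep => j; case: (hx j) => // h.
  by case: nx; exists j.
rewrite mulfVK ?mul1r ?subrr //; apply/prodf_neq0 => j _.
by rewrite ip_eq0 q0.
Qed.

Lemma multilinear_basis_ext f g n (e : forall j, 'I_(n j) -> V j) :
  (forall j, orthonormal_basis (ip j) (e j)) ->
  multilinear f -> multilinear g ->
  (forall w : forall j, 'I_(n j), f (fun j => e j (w j)) = g (fun j => e j (w j))) ->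
  forall x, f x = g x.
Proof.
move=> he fl gl h x; apply/eqP; rewrite -subr_eq0 -[g x]mul1r; apply/eqP; move: x.
apply: (@multilinear_vanish _ _ _ (fun j v => exists i, v = e j i)).
- move=> j k kl k0 v; have [_ hej] := he j; rewrite [v]hej.
  elim: (index_enum _) => [|i r IH].
    by rewrite big_nil; have := kl (-1) 0 0; rewrite scaler0 addr0 mulN1r addNr.
  by rewrite big_cons kl IH k0 ?mulr0 ?addr0 //; exists i.
- exact: multilinear_lc.
move=> x hx; pose w j := sval (cid (hx j)).
have -> : x = fun j => e j (w j).
  by apply: functional_extensionality_dep => j; apply: svalP (cid (hx j)).
by rewrite mul1r h subrr.
Qed.

(* The form x |-> <x_1 (x) ... (x) x_d, T>, cf. [form_tens]. *)
Definition form (T : tensor V) x : K :=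
  \sum_(i : tindex V) theta (T i) * \prod_j ip j (x j) (vbasis {:V j})`_(i j).

Lemma form_multilinear T : multilinear (form T).
Proof.
apply: multilinear_bigsum => i; apply: multilinear_scale.
exact: (multilinear_prod (fun j => @ip_scalar _ (ip j) (vbasis {:V j})`_(i j))).
Qed.

Lemma formP a T T' x : form (a *: T + T') x = theta a * form T x + form T' x.
Proof.
rewrite /form mulr_sumr -big_split; apply: eq_bigr => i _ /=.
by rewrite !ffunE rmorphD rmorphM mulrDl mulrA.
Qed.

Lemma form_sum (I : Type) (r : seq I) (P : pred I) (F : I -> tensor V) x :
  form (\sum_(i <- r | P i) F i) x = \sum_(i <- r | P i) form (F i) x.
Proof.
apply: (big_morph (fun T => form T x)) => [T T'|].
  by rewrite -[T]scale1r formP rmorph1 mul1r scale1r.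
by rewrite /form big1 // => i _; rewrite ffunE rmorph0 mul0r.
Qed.

Lemma formZ a T x : form (a *: T) x = theta a * form T x.
Proof.
rewrite /form mulr_sumr; apply: eq_bigr => i _.
by rewrite ffunE rmorphM mulrA.
Qed.

(** Both sides are conjugate-multilinear in [v]; after applying [theta] they are compared on basis
    vectors, where [tens] is a unit array. *)
Lemma form_tens (v : forall j, V j) x : form (tens v) x = \prod_j ip j (x j) (v j).
Proof.
apply: (can_inj (conjgK KP)); apply/eqP; rewrite -subr_eq0 -[theta (\prod_j _)]mul1r.
apply/eqP; move: v.
apply: (@multilinear_vanish _ _ _ (fun j v =>
  exists i, v = (vbasis {:V j})`_i /\ (i < \dim {:V j})%N)).
- move=> j g gl g0 v; have g00 : g 0 = 0.
    by have := gl (-1) 0 0; rewrite scaler0 addr0 mulN1r addNr.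
  rewrite (coord_vbasis (memvf v)).
  elim: (index_enum _) => [|i r IH]; first by rewrite big_nil.
  by rewrite big_cons gl IH g0 ?mulr0 ?addr0 //; exists i.
- apply: multilinear_lc => [v j a y z|].
    by rewrite /upd tens_multilinear formP rmorphD rmorphM /= (conjgK KP).
  move=> v j a y z; rewrite !rmorph_prod.
  apply: (multilinear_prod (phi := fun j y => theta (ip j (x j) y))) => {}j {}a {}y {}z.
  by rewrite /= ipDr ipZr rmorphD rmorphM /= (conjgK KP).
move=> v hv; pose i : tindex V := [ffun j => Ordinal (svalP (cid (hv j))).2].
have -> : v = fun j => (vbasis {:V j})`_(i j).
  apply: functional_extensionality_dep => j; rewrite ffunE /=.
  exact: (svalP (cid (hv j))).1.
rewrite mul1r tens_basis /form (bigD1 i) //= ffunE eqxx rmorph1 mul1r.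
rewrite [X in theta (_ + X)]big1 ?addr0 ?subrr //.
by move=> k /negPf ki; rewrite ffunE ki rmorph0 mul0r.
Qed.

(** Evaluation at the Riesz vectors of the coordinate functionals recovers the entries of the tensor
    up to [theta]. *)
Lemma form_inj T T' : (forall x, form T x = form T' x) -> T = T'.
Proof.
move=> h; apply/ffunP => i.
pose r j := riesz KP (ip j) (coord (vbasis {:V j}) (i j)).
have fr S : form S r = theta (S i).
  have hr j k : ip j (r j) (vbasis {:V j})`_k = coord (vbasis {:V j}) (i j) (vbasis {:V j})`_k.
    rewrite (ipC (ip j)) rieszP; last by move=> a y z; rewrite linearP.
    case: (ltnP k (\dim {:V j})) => [kd|kd].
      by rewrite (coord_free (Ordinal kd) (i j)) ?rmorph_nat ?(basis_free (vbasisP _)).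
    by rewrite nth_default ?size_tuple // linear0 rmorph0.
  rewrite /form (bigD1 i) //= big1 ?mulr1; last first.
    by move=> j _; rewrite hr coord_free ?eqxx ?(basis_free (vbasisP _)).
  rewrite big1 ?addr0 // => k ki.
  have /existsP[j kj] : [exists j, k j != i j].
    apply: contraNT ki; rewrite negb_exists => /forallP e.
    by apply/eqP/ffunP => j; apply/eqP; have := e j; rewrite negbK.
  rewrite (bigD1 j) //= hr coord_free ?(basis_free (vbasisP _)) //.
  by rewrite -[(_ == _)]/(k j == i j) (negPf kj) mul0r mulr0.
by apply: (can_inj (conjgK KP)); rewrite -!fr h.
Qed.

End MultilinearInner.

(** * Ordinary tensors *)

Section SimultaneousSVD.
Variables (K : numFieldType) (theta : {rmorphism K -> K}).
Hypothesis KP : scalar_field theta.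
Variables (V W : vectType K) (ipV : {dot V for theta}) (ipW : {dot W for theta}).
Variables (U : Type) (rho : U -> V -> W) (sigma : U -> W -> V).
Hypothesis rho_semilinear :
  forall u a x y, rho u (a *: x + y) = theta a *: rho u x + rho u y.
Hypothesis sigma_semilinear :
  forall u a x y, sigma u (a *: x + y) = theta a *: sigma u x + sigma u y.
Hypothesis rho_sigma : forall u x y, ipW y (rho u x) = ipV x (sigma u y).
Hypothesis triple :
  forall u v w x, rho v (sigma w (rho u x)) = rho u (sigma w (rho v x)).

Lemma ip_sigma u x y : ipV (sigma u y) x = ipW (rho u x) y.
Proof. by rewrite (ipC ipV) -rho_sigma -(ipC ipW). Qed.

Lemma triple_adjoint u v w y :
  sigma v (rho w (sigma u y)) = sigma u (rho w (sigma v y)).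
Proof.
apply: (ip_ext (ip := ipV)) => x.
by rewrite !ip_sigma !rho_sigma !ip_sigma triple.
Qed.

Lemma rho0 u : rho u 0 = 0.
Proof. by have := rho_semilinear u (-1) 0 0; rewrite scaler0 addr0 rmorphN1 scaleN1r addNr. Qed.

Lemma rhoZ u a x : rho u (a *: x) = theta a *: rho u x.
Proof. by have := rho_semilinear u a x 0; rewrite rho0 !addr0. Qed.

(** The maps [sigma w (rho u x)] are linear in [x]. Taking adjoints exchanges [u] and [w], and two
    such maps commute by [triple] followed by [triple_adjoint]. The premise makes them self-adjoint
    when [theta] is the identity. *)
Lemma sigma_rho_eigenbasis :
  (theta =1 id -> forall u w x, sigma w (rho u x) = sigma u (rho w x)) ->
  exists n (e : 'I_n -> V), orthonormal_basis ipV e /\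
    forall u w k, exists l, sigma w (rho u (e k)) = l *: e k.
Proof.
move=> sym.
have HH (i : U * U) : exists A : 'End(V), forall x, A x = sigma i.2 (rho i.1 x).
  by apply: ex_lfun => a x y; rewrite rho_semilinear sigma_semilinear (conjgK KP).
pose A i := sval (cid (HH i)); have AE i x : A i x = sigma i.2 (rho i.1 x).
  by have := svalP (cid (HH i)); apply.
have adj i x y : ipV (A i x) y = ipV x (A (i.2, i.1) y).
  by rewrite !AE /= ip_sigma rho_sigma.
case: (@spectral_basis _ _ KP V ipV _ A) => [i|i j x|th i x y|n [e [eb ee]]].
- by exists (i.2, i.1); apply: adj.
- by rewrite !AE (triple j.1 i.1) triple_adjoint.
- by rewrite adj !AE sym.
exists n, e; split=> // u w k; have [l hl] := ee (u, w) k.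
by exists l; rewrite -hl AE.
Qed.

Section Eigenbasis.
Variables (n : nat) (e : 'I_n -> V).
Hypothesis eP : orthonormal_basis ipV e.
Hypothesis e_eigen : forall u w k, exists l, sigma w (rho u (e k)) = l *: e k.

Lemma rho_eigen_orthogonal u w i j : i != j ->
  ipW (rho u (e i)) (rho w (e j)) = 0.
Proof.
move=> /negPf ij; rewrite -ip_sigma; have [l ->] := e_eigen w u j.
by rewrite ipZl eP.1 eq_sym ij mulr0.
Qed.

(** For a fixed nonzero [rho v (e k)], the identity [triple] equates a multiple of it with a
    multiple of [rho u (e k)]; the latter factor is nonzero because the eigenvalue [h] is. *)
Lemma rho_eigen_line (u0 : U) k :
  exists v, forall u, exists c, rho u (e k) = c *: rho v (e k).
Proof.
case: (pselect (exists v, rho v (e k) != 0)) => [[v hv]|h]; last first.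
  exists u0 => u; exists 0; rewrite scale0r; apply/eqP/negPn/negP => hu.
  by apply: h; exists u.
exists v => u; have [h hh] := e_eigen v v k; have [l hl] := e_eigen u v k.
have := triple v u v (e k); rewrite hl hh !rhoZ => e1.
have h0 : h != 0.
  apply: contraNneq hv => h0; rewrite -(ip_eq0 ipW) -ip_sigma hh h0.
  by rewrite scale0r ip0l.
exists ((theta h)^-1 * theta l).
by rewrite -scalerA -e1 scalerA mulVf ?fmorph_eq0 // scale1r.
Qed.

End Eigenbasis.
End SimultaneousSVD.

(** * From the slot identities to an orthogonal decomposition *)

Section Ordinary.
Variables (K : numFieldType) (theta : {rmorphism K -> K}).
Hypothesis KP : scalar_field theta.
Variables (d : nat) (V : 'I_d -> vectType K) (ip : forall j, {dot (V j) for theta}).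
Variables (i0 i1 : 'I_d) (f : (forall j, V j) -> K).
Implicit Types (u v w x : forall j, V j).

(* [slotr l u] and [slotl u] are the maps A_u and A_u^* between V_0 and V_l; u has
   entries in the slots i0 and l as well, which are irrelevant. *)
Definition slotr l u (s : V i0) : V l :=
  riesz KP (ip l) (fun t => f (upd (upd u s) t)).

Definition slotl l u (t : V l) : V i0 :=
  riesz KP (ip i0) (fun s => f (upd (upd u s) t)).

Hypothesis f_lin : multilinear f.
Hypothesis i10 : i1 != i0.

Lemma ip_slotr l u (s : V i0) (t : V l) : ip l t (slotr l u s) = f (upd (upd u s) t).
Proof. by rewrite rieszP //; apply: f_lin. Qed.

Lemma ip_slotl l u (s : V i0) (t : V l) : l != i0 -> ip i0 s (slotl u t) = f (upd (upd u s) t).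
Proof.
move=> l0; rewrite rieszP // => a y z.
have e (s' : V i0) : upd (upd u s') t = upd (upd u t) s' by rewrite updC // eq_sym.
by rewrite !e f_lin.
Qed.

Lemma slotr_semilinear l u a (s s' : V i0) : l != i0 ->
  slotr l u (a *: s + s') = theta a *: slotr l u s + slotr l u s'.
Proof.
move=> l0; apply/(ip_ext (ip := ip l)) => t; rewrite [LHS]ipC [RHS]ipC.
congr (theta _); rewrite ipDr ipZr (conjgK KP) !ip_slotr.
by rewrite -!(ip_slotl u _ t l0) ipDl ipZl.
Qed.

Lemma slotl_semilinear l u a (t t' : V l) : l != i0 ->
  slotl u (a *: t + t') = theta a *: slotl u t + slotl u t'.
Proof.
move=> l0; apply/(ip_ext (ip := ip i0)) => s; rewrite [LHS]ipC [RHS]ipC.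
by congr (theta _); rewrite ipDr ipZr (conjgK KP) !ip_slotl // f_lin.
Qed.

Lemma slotr_slotl l u (s : V i0) (t : V l) : l != i0 ->
  ip l t (slotr l u s) = ip i0 s (slotl u t).
Proof. by move=> l0; rewrite ip_slotr ip_slotl. Qed.

Definition slots_triple := forall l, l != i0 -> forall u v w s,
  slotr l v (slotl w (slotr l u s)) = slotr l u (slotl w (slotr l v s)).

Definition slots_symmetric := forall l, l != i0 -> forall u w,
  (forall s, slotl w (slotr l u s) = slotl u (slotr l w s)) /\
  (forall t : V l, slotr l w (slotl u t) = slotr l u (slotl w t)).

(** Three exchanges of adjacent indices reverse the word [v], [w], [u]. *)
Lemma slots_symmetric_triple : slots_symmetric -> slots_triple.
Proof.
move=> sym l l0 u v w s; by rewrite (sym l l0 w v).2 (sym l l0 u v).1 (sym l l0 u w).2.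
Qed.

Section Eigenbasis.
Hypothesis triple : slots_triple.
Variables (n : nat) (e : 'I_n -> V i0).
Hypothesis eP : orthonormal_basis (ip i0) e.

Definition slot_eigen l :=
  forall u w k, exists c, slotl w (slotr l u (e k)) = c *: e k.

(** All vectors [slotr l u (e m)] lie on one line, generated by [q]; with [e m] in slot [i0] the
    form therefore sees slot [l] only through [q]. *)
Lemma eigen_slot l m : l != i0 -> slot_eigen l ->
  exists q : V l, (exists u, q = slotr l u (e m)) /\
    forall x, x i0 = e m -> ip l (x l) q = 0 -> f x = 0.
Proof.
move=> l0 el.
have [u0 hu0] := rho_eigen_line
  (fun u a s s' => slotr_semilinear u a s s' l0)
  (fun u s t => slotr_slotl u s t l0) (triple l0) el (fun _ => 0) m.
exists (slotr l u0 (e m)); split; first by exists u0.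
(* The tuple [x] itself is the filling of the other slots. *)
move=> x xm xq; have [c hc] := hu0 x.
by rewrite -(upd_id x l) -{1}(upd_id x i0) xm -ip_slotr hc ipZr xq mulr0.
Qed.

(** It suffices that the images of distinct [e j] and [e k] in slot [l] are orthogonal. With [e m]
    in slot [i0] only the component of slot [i1] along [q m] matters, so the two fillings may be
    given [q j] and [q k] there. The orthogonality of [q j] and [q k] and the triple identity then
    give the claim. *)
Lemma eigen_transfer l : l != i0 -> slot_eigen i1 -> slot_eigen l.
Proof.
move=> l0 e1; case: (eqVneq l i1) => [->//|l1] u w k.
have [_ he] := eP; rewrite [slotl _ _]he.
exists (ip i0 (slotl w (slotr l u (e k))) (e k)).
rewrite (bigD1 k) //= big1 ?addr0 // => j jk.
rewrite (ip_sigma (fun u s t => slotr_slotl u s t l0)).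
suff -> : ip l (slotr l w (e j)) (slotr l u (e k)) = 0 by rewrite scale0r.
have hq m : exists q : V i1, (exists u, q = slotr i1 u (e m)) /\
    forall x, x i0 = e m -> ip i1 (x i1) q = 0 -> f x = 0 by exact: eigen_slot.
pose q m := sval (cid (hq m)).
have q_slot m : exists u, q m = slotr i1 u (e m) by have [] := svalP (cid (hq m)).
have q_van m x : x i0 = e m -> ip i1 (x i1) (q m) = 0 -> f x = 0.
  by have [_] := svalP (cid (hq m)); apply.
have q_orth : ip i1 (q j) (q k) = 0.
  have [u1 ->] := q_slot j; have [u2 ->] := q_slot k.
  exact: (rho_eigen_orthogonal (fun u s t => slotr_slotl u s t i10) eP e1).
have scal m v : exists a, slotr l v (e m) = a *: slotr l (upd v (q m)) (e m).
  pose b := ip i1 (v i1) (q m) / ip i1 (q m) (q m).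
  exists (theta b); apply: (ip_ext (ip := ip l)) => t.
  rewrite [LHS]ipC [RHS]ipC; congr (theta _).
  rewrite ipZr (conjgK KP) !ip_slotr.
  pose x := upd (upd v (e m)) t.
  have -> : upd (upd (upd v (q m)) (e m)) t = upd x (q m).
    by rewrite (updC v) // updC // eq_sym.
  apply/eqP; rewrite -subr_eq0 -(multilinearZ x _ _ f_lin).
  have xv : x i1 = v i1 by rewrite /x !upd_neq // eq_sym.
  rewrite -[X in f X - _](upd_id x i1) -(multilinearB _ _ _ f_lin); apply/eqP.
  apply: (q_van m).
    by rewrite upd_neq 1?eq_sym // /x upd_neq 1?eq_sym // upd_same.
  rewrite upd_same ipBl ipZl xv /b; case: (eqVneq (q m) 0) => [->|q0].
    by rewrite !ip0r mulr0 subrr.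
  by rewrite mulfVK ?subrr // ip_eq0.
have [a ->] := scal j w; have [b ->] := scal k u.
rewrite ipZl ipZr; set w' := upd w (q j); set u' := upd u (q k).
suff -> : ip l (slotr l w' (e j)) (slotr l u' (e k)) = 0 by rewrite !mulr0.
set s := slotr l u' (e k).
(* With [q j] in slot [i1] the map of [w'] kills [e k], and the triple identity lets it act on [e k]
   first. *)
have s0 : slotr l w' (slotl w' s) = 0.
  rewrite /s triple // (_ : slotr l w' (e k) = 0).
    have lin := slotl_semilinear w' (-1) 0 0 l0.
    have rin := slotr_semilinear u' (-1) 0 0 l0.
    rewrite scaler0 addr0 rmorphN1 scaleN1r addNr in lin.
    by rewrite scaler0 addr0 rmorphN1 scaleN1r addNr in rin; rewrite lin rin.
  apply: (ip_ext (ip := ip l)) => t; rewrite ip0l ipC ip_slotr (q_van k) ?rmorph0 //.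
    by rewrite upd_neq ?upd_same // eq_sym.
  by rewrite upd_neq 1?eq_sym // upd_neq // /w' upd_same.
have /eqP : ip i0 (slotl w' s) (slotl w' s) = 0.
  by rewrite -(slotr_slotl _ _ _ l0) s0 ip0r.
rewrite ip_eq0 => /eqP s1.
by rewrite -(ip_sigma (fun u s t => slotr_slotl u s t l0)) s1 ip0l.
Qed.

End Eigenbasis.

(** Slot [i0] receives the eigenbasis, every other slot the vectors of [eigen_slot]. Expanding slot
    [i0] writes [f] as a sum of forms [h m], each of which vanishes once an entry is orthogonal to
    [q m] and is thus pure by [multilinear_pure]. *)
Lemma slots_triple_deco : slots_triple -> (theta =1 id -> slots_symmetric) ->
  exists (k : nat) (v : 'I_k -> forall j, V j),
    (forall j, orthogonal_family (ip j) (fun i => v i j)) /\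
    forall x, f x = \sum_i \prod_j ip j (x j) (v i j).
Proof.
move=> triple sym.
have [n [e [eP ee]]] := sigma_rho_eigenbasis KP
  (fun u a s s' => slotr_semilinear u a s s' i10)
  (fun u a s s' => slotl_semilinear u a s s' i10)
  (fun u s t => slotr_slotl u s t i10) (triple _ i10)
  (fun h u w s => (sym h _ i10 u w).1 s).
(* The clause for l = i0 states q = e m without a type cast. *)
have ex_q m l : exists q : V l, [/\ l = i0 -> forall x, x l = q -> x i0 = e m,
    l != i0 -> exists u, q = slotr l u (e m) &
    l != i0 -> forall x, x i0 = e m -> ip l (x l) q = 0 -> f x = 0].
  case: (eqVneq l i0) => [->|l0]; first by exists (e m); split.
  have [q [h1 h2]] := eigen_slot triple m l0 (eigen_transfer triple eP l0 ee).
  by exists q; split=> // e0; rewrite e0 eqxx in l0.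
pose q m l := sval (cid (ex_q m l)).
have q0 m : q m i0 = e m.
  by have [h _ _] := svalP (cid (ex_q m i0)); apply: (h erefl (q m)).
have q_orth l i j : i != j -> ip l (q i l) (q j l) = 0.
  move=> ij; case: (eqVneq l i0) => [->|l0].
    by rewrite !q0 eP.1 (negPf ij).
  have [_ /(_ l0)[u hu] _] := svalP (cid (ex_q i l)).
  have [_ /(_ l0)[w hw] _] := svalP (cid (ex_q j l)).
  rewrite /q hu hw; apply: (rho_eigen_orthogonal
    (fun u s t => slotr_slotl u s t l0) eP (eigen_transfer triple eP l0 ee)) => //.
have q_van m l x : l != i0 -> x i0 = e m -> ip l (x l) (q m l) = 0 -> f x = 0.
  by move=> l0; have [_ _ /(_ l0)] := svalP (cid (ex_q m l)); apply.
pose h m x := ip i0 (x i0) (e m) * f (upd x (e m)).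
have h_lin m : multilinear (h m).
  move=> x j a y z; rewrite /h; case: (eqVneq j i0) => [j0|j0].
    by subst j; rewrite !upd_same !upd_upd ipDl ipZl mulrDl mulrA.
  rewrite !(upd_neq _ _ (_ : i0 != j)) 1?eq_sym //.
  have e' (y' : V j) : upd (upd x y') (e m) = upd (upd x (e m)) y' by rewrite updC.
  by rewrite !e' f_lin mulrDr mulrCA.
have h_van m x j : ip j (x j) (q m j) = 0 -> h m x = 0.
  case: (eqVneq j i0) => [->|j0] xq; first by rewrite /h -(q0 m) xq mul0r.
  by rewrite /h (q_van m j) ?mulr0 ?upd_same ?upd_neq.
have fE x : f x = \sum_m h m x.
  rewrite -{1}(upd_id x i0); have [_ he] := eP; rewrite {1}[x i0]he.
  rewrite (multilinear_sum _ _ _ _ f_lin); apply: eq_bigr => m _.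
  by rewrite (multilinearZ _ _ _ f_lin).
pose c m := h m (q m) / \prod_j ip j (q m j) (q m j).
have hE m x : h m x = c m * \prod_j ip j (x j) (q m j).
  case: (pselect (forall j, q m j != 0)) => [qn0|].
    by apply: (multilinear_pure (h_lin m)) => // y j; apply: h_van.
  (* If some [q m j] is zero, [h m] and [c m] both vanish, the latter through its numerator. *)
  move=> /existsNP[j /negP/negPn/eqP qj].
  by rewrite (h_van m x j) ?qj ?ip0r // /c (h_van m _ j) ?qj ?ip0r // !mul0r.
have c_q m j : c m != 0 -> q m j != 0.
  by apply: contraNneq => qj; rewrite /c (h_van m _ j) ?qj ?ip0r // mul0r.
(* Only terms with nonzero coefficient are kept, so that their vectors are nonzero. The coefficient
   is absorbed into slot [i0], conjugated because it enters the second argument of [ip]. *)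
pose S := [pred m | c m != 0].
exists #|S|, (fun i => upd (q (enum_val i)) (theta (c (enum_val i)) *: e (enum_val i))).
split=> [j|x].
  have vE i : exists2 a, a != 0 & upd (q (enum_val i))
      (theta (c (enum_val (A := S) i)) *: e (enum_val i)) j = a *: q (enum_val i) j.
    case: (eqVneq j i0) => [->|j0]; last first.
      by exists 1; rewrite ?oner_eq0 // upd_neq // scale1r.
    exists (theta (c (enum_val i))); last by rewrite upd_same q0.
    by rewrite fmorph_eq0; have := enum_valP i.
  split=> [i|i k ik].
    have [a a0 ->] := vE i; rewrite scaler_eq0 negb_or a0 c_q //.
    by have := enum_valP i.
  have [a _ ->] := vE i; have [b _ ->] := vE k.
  by rewrite ipZl ipZr q_orth ?mulr0 // (inj_eq enum_val_inj).
rewrite fE (bigID (mem S)) /= [X in _ + X]big1 ?addr0; last first.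
  by move=> m; rewrite inE negbK hE => /eqP ->; rewrite mul0r.
rewrite big_enum_val /=; apply: eq_bigr => i _; rewrite hE (bigD1 i0) //=.
rewrite [RHS](bigD1 i0) //= upd_same ipZr (conjgK KP) mulrA q0; congr (_ * _).
by apply: eq_bigr => j j0; rewrite upd_neq.
Qed.

End Ordinary.

(** * The slot identities for decomposable tensors *)

Section OrdinaryForward.
Variables (K : numFieldType) (theta : {rmorphism K -> K}).
Hypothesis KP : scalar_field theta.
Variables (d : nat) (V : 'I_d -> vectType K) (ip : forall j, {dot (V j) for theta}).
Variables (i0 : 'I_d) (f : (forall j, V j) -> K).
Variables (k : nat) (a : 'I_k -> forall j, V j).
Hypothesis a_orth : forall j, orthogonal_family (ip j) (fun i => a i j).
Hypothesis fE : forall x, f x = \sum_i \prod_j ip j (x j) (a i j).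
Implicit Types (u v w x : forall j, V j).

Let c l u i := \prod_(j | (j != i0) && (j != l)) ip j (u j) (a i j).

Let f_lin : multilinear f.
Proof.
move=> x j b y z /=; rewrite !fE mulr_sumr -big_split; apply: eq_bigr => i _.
exact: (multilinear_prod (fun j => @ip_scalar _ _ _ (ip j) (a i j))).
Qed.

Let f_upd l u (s : V i0) (t : V l) : l != i0 ->
  f (upd (upd u s) t) = \sum_i c l u i * ip i0 s (a i i0) * ip l t (a i l).
Proof.
move=> l0; rewrite fE; apply: eq_bigr => i _.
rewrite (bigD1 i0) //= (bigD1 l) //= upd_same upd_neq 1?eq_sym // upd_same.
rewrite mulrA mulrC mulrA; congr (_ * _ * _).
by apply: eq_bigr => j /andP[j0 jl]; rewrite !upd_neq.
Qed.

Let slotrE l u s : l != i0 -> slotr KP ip f l u s =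
  \sum_i theta (c l u i * ip i0 s (a i i0)) *: a i l.
Proof.
move=> l0; apply: (ip_ext (ip := ip l)) => t; rewrite [LHS]ipC [RHS]ipC.
congr (theta _); rewrite ip_slotr // f_upd // ip_sumr.
by apply: eq_bigr => i _; rewrite ipZr (conjgK KP).
Qed.

Let slotlE l u (t : V l) : l != i0 -> slotl KP ip i0 f u t =
  \sum_i theta (c l u i * ip l t (a i l)) *: a i i0.
Proof.
move=> l0; apply: (ip_ext (ip := ip i0)) => s; rewrite [LHS]ipC [RHS]ipC.
congr (theta _); rewrite ip_slotl // f_upd // ip_sumr.
by apply: eq_bigr => i _; rewrite ipZr (conjgK KP) mulrAC.
Qed.

Let ip_family j (b : 'I_k -> K) i :
  ip j (\sum_i' b i' *: a i' j) (a i j) = b i * ip j (a i j) (a i j).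
Proof.
rewrite ip_suml (bigD1 i) //= ipZl big1 ?addr0 // => i' ne.
by rewrite ipZl (a_orth j).2 // mulr0.
Qed.

(** Slot maps are diagonal with respect to the orthogonal families [a], so both sides are sums over
    [i] whose coefficients are symmetric in [u] and [v]. *)
Lemma deco_slots_triple : slots_triple KP ip i0 f.
Proof.
move=> l l0 u v w s; rewrite !(slotrE _ _ l0) !(slotlE _ _ l0).
apply: eq_bigr => i _; congr (theta _ *: _); rewrite !ip_family.
by rewrite !rmorphM /= !(conjgK KP); ring.
Qed.

Lemma deco_slots_symmetric : theta =1 id -> slots_symmetric KP ip i0 f.
Proof.
move=> th l l0 u w; split=> x; rewrite !(slotrE _ _ l0) !(slotlE _ _ l0) ?slotrE //.
all: apply: eq_bigr => i _; congr (theta _ *: _); rewrite !ip_family !th.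
all: by ring.
Qed.

End OrdinaryForward.

(* Abstract properties of the functions w |-> F w on W that are given, up to
   separating real and imaginary parts, by homogeneous real polynomials of
   degree n in the real coordinates of w. *)
Record polynomial_functions (K : fieldType) (theta : K -> K) (W : lmodType K)
    (polyfun : nat -> (W -> K) -> Prop) : Prop := PolynomialFunctions {
  polyfun_scalar : forall g : W -> K, scalar g -> polyfun 1 g;
  polyfun0 : forall n, polyfun n (fun => 0);
  polyfunP : forall n a F G, polyfun n F -> polyfun n G ->
    polyfun n (fun w => a * F w + G w);
  polyfunM : forall m n F G, polyfun m F -> polyfun n G ->
    polyfun (m + n) (fun w => F w * G w);
  polyfun_conj : forall n F, polyfun n F -> polyfun n (fun w => theta (F w)) }.

Section PolynomialFunctions.
Variables (K : fieldType) (theta : K -> K) (W : lmodType K).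
Variables (polyfun : nat -> (W -> K) -> Prop).
Hypothesis PF : polynomial_functions theta polyfun.

Lemma eq_polyfun n F G : F =1 G -> polyfun n F -> polyfun n G.
Proof. by move=> /funext ->. Qed.

Lemma polyfunB n F G : polyfun n F -> polyfun n G ->
  polyfun n (fun w => F w - G w).
Proof.
move=> pF pG; apply: (eq_polyfun _ (polyfunP PF (-1) pG pF)) => w.
by rewrite mulN1r addrC.
Qed.

Lemma polyfun_sum n I (r : seq I) (F : I -> W -> K) :
  (forall i, polyfun n (F i)) -> polyfun n (fun w => \sum_(i <- r) F i w).
Proof.
move=> pF; elim: r => [|i r IH].
  by apply: (eq_polyfun _ (polyfun0 PF n)) => w; rewrite big_nil.
apply: (eq_polyfun _ (polyfunP PF 1 (pF i) IH)) => w.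
by rewrite big_cons mul1r.
Qed.

Lemma polyfunZ n a F : polyfun n F -> polyfun n (fun w => a * F w).
Proof.
move=> pF; apply: (eq_polyfun _ (polyfunP PF a pF (polyfun0 PF n))) => w.
by rewrite addr0.
Qed.

End PolynomialFunctions.

(** * Degrees of the slot identities *)

Section OrdinaryPolynomials.
Variables (K : numFieldType) (theta : {rmorphism K -> K}).
Hypothesis KP : scalar_field theta.
Variables (d : nat) (V : 'I_d -> vectType K) (ip : forall j, {dot (V j) for theta}).
Variables (W : lmodType K) (L : W -> tensor V).
Hypothesis L_linear : forall a x y, L (a *: x + y) = a *: L x + L y.
Variables (polyfun : nat -> (W -> K) -> Prop).
Hypothesis PF : polynomial_functions theta polyfun.
Variables (i0 i1 : 'I_d).
Hypothesis i10 : i1 != i0.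

Local Notation f w := (form ip (L w)).

(** The form is conjugate-linear in the tensor, so its conjugate is a linear function; conjugating
    again returns to the form. *)
Lemma polyfun_form x : polyfun 1 (fun w => f w x).
Proof.
have pl := @polyfun_conj _ _ _ _ PF 1 (fun w => theta (f w x)).
apply: (eq_polyfun _ (pl _)) => [w|]; first by rewrite (conjgK KP).
apply: (polyfun_scalar PF) => a w w'.
by rewrite L_linear formP rmorphD rmorphM /= (conjgK KP).
Qed.

Definition vpolyfun (U : vectType K) (ipU : {dot U for theta}) n (y : W -> U) :=
  forall z, polyfun n (fun w => ipU (y w) z).

Lemma polyfun_upd n j x (y : W -> V j) : vpolyfun (ip j) n y ->
  polyfun n.+1 (fun w => f w (upd x (y w))).
Proof.
move=> py; apply: (@eq_polyfun _ _ _ _ (fun w =>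
  \sum_b ip j (y w) (onb KP (ip j) b) * f w (upd x (onb KP (ip j) b)))).
  move=> w; have [_ he] := onbP KP (ip j); rewrite [in RHS](he (y w)).
  rewrite (multilinear_sum _ _ _ _ (form_multilinear _ _)).
  by apply: eq_bigr => b _; rewrite (multilinearZ _ _ _ (form_multilinear _ _)).
apply: (polyfun_sum PF) => b; rewrite -addn1.
by apply: (polyfunM PF); [exact: py | exact: polyfun_form].
Qed.

Lemma vpolyfun_slotr n l u (s : W -> V i0) : l != i0 -> vpolyfun (ip i0) n s ->
  vpolyfun (ip l) n.+1 (fun w => slotr KP ip (f w) l u (s w)).
Proof.
move=> l0 ps z; apply: (@eq_polyfun _ _ _ _ (fun w => theta (f w (upd (upd u z) (s w))))).
  move=> w; rewrite [RHS]ipC ip_slotr; first by rewrite updC.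
  exact: form_multilinear.
by apply: (polyfun_conj PF); apply: polyfun_upd.
Qed.

Lemma vpolyfun_slotl n l u (t : W -> V l) : l != i0 -> vpolyfun (ip l) n t ->
  vpolyfun (ip i0) n.+1 (fun w => slotl KP ip i0 (f w) u (t w)).
Proof.
move=> l0 pt z; apply: (@eq_polyfun _ _ _ _ (fun w => theta (f w (upd (upd u z) (t w))))).
  by move=> w; rewrite [RHS]ipC ip_slotl //; apply: form_multilinear.
by apply: (polyfun_conj PF); apply: polyfun_upd.
Qed.

Lemma vpolyfun_slotr1 l u (s : V i0) :
  vpolyfun (ip l) 1 (fun w => slotr KP ip (f w) l u s).
Proof.
move=> z; apply: (@eq_polyfun _ _ _ _ (fun w => theta (f w (upd (upd u s) z)))).
  by move=> w; rewrite [RHS]ipC ip_slotr //; apply: form_multilinear.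
by apply: (polyfun_conj PF); apply: polyfun_form.
Qed.

Lemma vpolyfun_slotl1 l u (t : V l) : l != i0 ->
  vpolyfun (ip i0) 1 (fun w => slotl KP ip i0 (f w) u t).
Proof.
move=> l0 z; apply: (@eq_polyfun _ _ _ _ (fun w => theta (f w (upd (upd u z) t)))).
  by move=> w; rewrite [RHS]ipC ip_slotl //; apply: form_multilinear.
by apply: (polyfun_conj PF); apply: polyfun_form.
Qed.

Variables (X : W -> Prop) (D : nat).
Hypothesis X_deco : forall w, X w -> deco ip (L w).
Hypothesis D_deg : theta =1 id /\ D = 2 \/ ~ (theta =1 id) /\ D = 3.

Lemma deco_form T : deco ip T -> exists (k : nat) (v : 'I_k -> forall j, V j),
    (forall j, orthogonal_family (ip j) (fun i => v i j)) /\
    forall x, form ip T x = \sum_i \prod_j ip j (x j) (v i j).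
Proof.
move=> [k [v [vo ->]]]; exists k, v; split=> // x; rewrite form_sum.
by apply: eq_bigr => i _; rewrite form_tens.
Qed.

Lemma form_deco T (k : nat) (v : 'I_k -> forall j, V j) :
  (forall j, orthogonal_family (ip j) (fun i => v i j)) ->
  (forall x, form ip T x = \sum_i \prod_j ip j (x j) (v i j)) -> deco ip T.
Proof.
move=> vo hT; exists k, v; split=> //; apply: (form_inj KP (ip := ip)) => x.
rewrite hT form_sum; apply: eq_bigr => i _; by rewrite form_tens.
Qed.

Lemma polyfun_vanish_eq (U : vectType K) (ipU : {dot U for theta}) (y z : W -> U) w :
  (forall F, polyfun D F -> (forall w', X w' -> F w' = 0) -> F w = 0) ->
  vpolyfun ipU D y -> vpolyfun ipU D z -> (forall w', X w' -> y w' = z w') ->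
  y w = z w.
Proof.
move=> hw py pz yz; apply: (ip_ext (ip := ipU)) => t; apply/eqP.
rewrite -subr_eq0; apply/eqP; apply: (hw (fun w => ipU (y w) t - ipU (z w) t)).
  exact: (polyfunB PF).
by move=> w' Xw; rewrite yz // subrr.
Qed.

(** The components of the slot identities are polynomial functions of degree [D] that vanish on [X];
    hence they vanish at [w], and [slots_triple_deco] applies. *)
Lemma deco_polynomials w :
  (forall F, polyfun D F -> (forall w', X w' -> F w' = 0) -> F w = 0) ->
  deco ip (L w).
Proof.
move=> hw; have fl := form_multilinear ip (L w).
suff [tr sym] : slots_triple KP ip i0 (f w) /\
    (theta =1 id -> slots_symmetric KP ip i0 (f w)).
  have [k [v [vo hv]]] := slots_triple_deco fl i10 tr sym.
  exact: form_deco vo hv.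
(* For real scalars the quadratic identities are verified and imply the cubic one; otherwise the
   cubic one is verified directly. *)
have [[th D2]|[th D3]] := D_deg.
  suff sym : slots_symmetric KP ip i0 (f w).
    by split=> //; apply: slots_symmetric_triple.
  move=> l l0 u v; split=> x.
    pose y w' := slotl KP ip i0 (f w') v (slotr KP ip (f w') l u x).
    pose z w' := slotl KP ip i0 (f w') u (slotr KP ip (f w') l v x).
    apply: (@polyfun_vanish_eq _ (ip i0) y z w hw).
    - by rewrite D2; apply: vpolyfun_slotl => //; apply: vpolyfun_slotr1.
    - by rewrite D2; apply: vpolyfun_slotl => //; apply: vpolyfun_slotr1.
    move=> w' /X_deco/deco_form[k [a [ao ha]]].
    exact: (deco_slots_symmetric KP ao ha th l0 u v).1.
  pose y w' := slotr KP ip (f w') l v (slotl KP ip i0 (f w') u x).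
  pose z w' := slotr KP ip (f w') l u (slotl KP ip i0 (f w') v x).
  apply: (@polyfun_vanish_eq _ (ip l) y z w hw).
  - by rewrite D2; apply: vpolyfun_slotr => //; apply: vpolyfun_slotl1.
  - by rewrite D2; apply: vpolyfun_slotr => //; apply: vpolyfun_slotl1.
  move=> w' /X_deco/deco_form[k [a [ao ha]]].
  exact: (deco_slots_symmetric KP ao ha th l0 u v).2.
split=> [l l0 u v t x|/th//].
pose y w' := slotr KP ip (f w') l v (slotl KP ip i0 (f w') t (slotr KP ip (f w') l u x)).
pose z w' := slotr KP ip (f w') l u (slotl KP ip i0 (f w') t (slotr KP ip (f w') l v x)).
apply: (@polyfun_vanish_eq _ (ip l) y z w hw).
1,2: rewrite D3; apply: vpolyfun_slotr => //; apply: vpolyfun_slotl => //.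
1,2: exact: vpolyfun_slotr1.
move=> w' /X_deco/deco_form[k [a [ao ha]]].
exact: (deco_slots_triple KP ao ha l0).
Qed.

End OrdinaryPolynomials.

(** * Symmetric tensors *)

Section Symmetric.
Variables (K : numFieldType) (theta : {rmorphism K -> K}).
Hypothesis KP : scalar_field theta.
Variables (d : nat) (V : vectType K) (ip : {dot V for theta}).

Local Notation formV := (@form K theta d (fun=> V) (fun=> ip)).

Lemma form_tpermute s (T : tpower d V) x :
  formV (tpermute s T) x = formV T (fun j => x (s j)).
Proof.
pose h (s : 'S_d) (i : tindex (fun _ : 'I_d => V)) : tindex (fun _ : 'I_d => V) :=
  [ffun j => i (s j)].
have hK (t : 'S_d) : cancel (h t^-1%g) (h t).
  by move=> i; apply/ffunP => j; rewrite !ffunE permK.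
rewrite /form [RHS](reindex_onto (h s) (h s^-1%g)) /=; last first.
  by move=> i _; apply: hK.
rewrite [RHS](eq_bigl predT); last first.
  by move=> i; have := hK s^-1%g i; rewrite invgK => ->; rewrite eqxx.
apply: eq_bigr => i _; rewrite ffunE; congr (_ * _).
rewrite (reindex_inj (@perm_inj _ s)) /=.
by apply: eq_bigr => j _; rewrite ffunE.
Qed.

(** The equality case of Cauchy-Schwarz: the component of [y] orthogonal to [x] has norm zero. *)
Lemma norm_eq_parallel (x y : V) : x != 0 ->
  ip y x * ip x y = ip x x * ip y y -> y = (ip y x / ip x x) *: x.
Proof.
move=> x0 h; apply/eqP; rewrite -subr_eq0 -(ip_eq0 ip); apply/eqP.
have n0 : ip x x != 0 by rewrite ip_eq0.
set c := ip y x / ip x x; set w := y - c *: x.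
have wx : ip x w = 0.
  by rewrite ipC /w ipBl ipZl /c mulfVK // subrr rmorph0.
have wy : ip y w = 0.
  by rewrite ipC /w ipBl ipZl /c mulrAC h mulrAC mulfV // mul1r subrr rmorph0.
by rewrite {1}/w ipBl ipZl wx wy mulr0 subr0.
Qed.

Variable i0 : 'I_d.
Hypothesis d_ge3 : forall j : 'I_d, exists2 m, m != i0 & m != j.

(** Evaluate at [v i] with slots [i0] and [j] exchanged. A third slot [m] is untouched and kills all
    terms except the one of index [i] on both sides; what remains is equality in Cauchy-Schwarz for
    [v i i0] and [v i j]. *)
Lemma symmetric_parallel k (v : 'I_k -> 'I_d -> V) :
  (forall j, orthogonal_family ip (fun i => v i j)) ->
  (forall s : 'S_d, forall x : 'I_d -> V,
     \sum_i \prod_j ip (x (s j)) (v i j) = \sum_i \prod_j ip (x j) (v i j)) ->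
  forall i j, exists2 a, a != 0 & v i j = a *: v i i0.
Proof.
move=> vo sym i j; case: (eqVneq j i0) => [->|j0].
  by exists 1; rewrite ?oner_eq0 // scale1r.
have [m m0 mj] := d_ge3 j.
have v0 l : v i l != 0 by exact: (vo l).1.
have n0 l : ip (v i l) (v i l) != 0 by rewrite ip_eq0.
suff h : v i j = (ip (v i j) (v i i0) / ip (v i i0) (v i i0)) *: v i i0.
  exists (ip (v i j) (v i i0) / ip (v i i0) (v i i0)) => //.
  by apply: contraNneq (v0 j) => e; rewrite h e scale0r.
apply: norm_eq_parallel => //.
pose s := tperm i0 j; have := sym s (v i).
rewrite (bigD1 i) //= [X in _ + X]big1 ?addr0; last first.
  move=> i' ne; rewrite (bigD1 m) //= tpermD 1?eq_sym //.
  by rewrite (vo m).2 ?mul0r // eq_sym.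
rewrite [X in _ = X](bigD1 i) //= [X in _ = _ + X]big1 ?addr0; last first.
  move=> i' ne; rewrite (bigD1 m) //=.
  by rewrite (vo m).2 ?mul0r // eq_sym.
rewrite [X in X = _](bigD1 i0) //= [X in _ * X = _](bigD1 j) //=.
rewrite [X in _ = X](bigD1 i0) //= [X in _ = _ * X](bigD1 j) //=.
rewrite tpermL tpermR !mulrA (eq_bigr (fun l => ip (v i l) (v i l))); last first.
  by move=> l /andP[l0 lj]; rewrite tpermD // eq_sym.
by move/mulIf; apply; apply/prodf_neq0 => l _.
Qed.

Hypothesis ex_root : forall a : K, exists (e : bool) (b : K), a = (-1) ^+ e * b ^+ d.

(** Each term is the tensor power of [v i i0] times the product of the ratios [a i j]. This scalar
    is a sign times [b i ^+ d], and [b i] is absorbed into the vector. *)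
Lemma deco_sym_deco (T : subvs_of (Defs.Sym d V)) :
  deco (fun=> ip) (vsval T) -> sym_deco ip T.
Proof.
move=> [k [v [vo TE]]].
have TP : vsval T \in Defs.Sym d V := subvsP T.
have fT x : formV (vsval T) x = \sum_i \prod_j ip (x j) (v i j).
  by rewrite TE form_sum; apply: eq_bigr => i _; rewrite form_tens.
have par i j : exists2 a, a != 0 & v i j = a *: v i i0.
  apply: symmetric_parallel => // s x.
  by rewrite -!fT -form_tpermute (SymP _ TP).
pose a i j := sval (cid2 (par i j)).
have a0 i j : a i j != 0 by rewrite /a; case: cid2.
have va i j : v i j = a i j *: v i i0 by rewrite /a; case: cid2.
pose eps i := sval (cid (ex_root (\prod_j a i j))).
have ex_b i : exists b, \prod_j a i j = (-1) ^+ eps i * b ^+ d.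
  by rewrite /eps; case: cid.
pose b i := sval (cid (ex_b i)).
have bE i : \prod_j a i j = (-1) ^+ eps i * b i ^+ d by rewrite /b; case: cid.
have d0 : (0 < d)%N by apply: leq_trans (ltn_ord i0).
have b0 i : b i != 0.
  apply/negP => /eqP bi; have : \prod_j a i j == 0.
    by rewrite bE bi expr0n eqn0Ngt d0 mulr0.
  by apply/negP/prodf_neq0.
exists k, eps, (fun i => b i *: v i i0); split.
  split=> [i|i j ij]; first by rewrite scaler_eq0 negb_or b0 (vo i0).1.
  by rewrite ipZl ipZr (vo i0).2 ?mulr0.
apply: (form_inj KP (ip := fun=> ip)) => x; rewrite fT form_sum.
apply: eq_bigr => i _; rewrite formZ form_tens //.
under eq_bigr => j _ do rewrite va ipZr.
under [X in _ * X]eq_bigr => j _ do rewrite ipZr.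
rewrite !big_split /= -rmorph_prod bE mulrA; congr (_ * _).
by rewrite rmorphM prodr_const card_ord -rmorphXn.
Qed.

Lemma sym_deco_deco (T : subvs_of (Defs.Sym d V)) :
  sym_deco ip T -> deco (fun=> ip) (vsval T).
Proof.
move=> [k [eps [v [vo TE]]]].
exists k, (fun i => @upd d (fun=> V) (fun=> v i) i0 ((-1) ^+ eps i *: v i)); split.
  move=> j; case: (eqVneq j i0) => [->|j0]; last first.
    by split=> [i|i l il]; rewrite !upd_neq ?vo.1 ?vo.2.
  split=> [i|i l il]; rewrite !upd_same.
    by rewrite scaler_eq0 signr_eq0 /= vo.1.
  by rewrite ipZl ipZr vo.2 ?mulr0.
rewrite TE; apply: eq_bigr => i _.
apply: (form_inj KP (ip := fun=> ip)) => x; rewrite formZ !form_tens //.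
rewrite [RHS](bigD1 i0) //= upd_same ipZr (bigD1 i0) //= mulrA.
by congr (_ * _); apply: eq_bigr => j j0; rewrite upd_neq.
Qed.

End Symmetric.

(** * Alternating tensors *)

Lemma multilinear_slot (K : fieldType) (d : nat) (V : 'I_d -> vectType K)
    (f : (forall j, V j) -> K) (j : 'I_d) (A : V j -> V j) :
  multilinear f -> (forall a y z, A (a *: y + z) = a *: A y + A z) ->
  multilinear (fun x => f (upd x (A (x j)))).
Proof.
move=> fl Al x l a y z /=; case: (eqVneq l j) => [e|lj].
  by subst l; rewrite !upd_same !upd_upd Al fl.
rewrite !(upd_neq _ _ (_ : j != l)) 1?eq_sym //.
have e (y' : V l) : upd (upd x y') (A (x j)) = upd (upd x (A (x j))) y'.
  by rewrite updC.
by rewrite !e fl.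
Qed.

(** * From the alternating conditions to a decomposition *)

Section AlternatingForm.
Variables (K : numFieldType) (theta : {rmorphism K -> K}).
Hypothesis KP : scalar_field theta.
Variables (d : nat) (V : vectType K) (ip : {dot V for theta}).
Variables (i0 i1 : 'I_d) (f : ('I_d -> V) -> K).

Local Notation b := (onb KP ip).
Local Notation updv x j y := (@upd d (fun=> V) x j y).
Implicit Types (x u : 'I_d -> V) (y z w v : V).

(* The inner product of the forms f(z, u, ...) and f(w, v, ...), up to a
   positive factor: the sum runs over all d slots, while the slots i0 and i1 are
   occupied. *)
Definition gram z y w v : K := \sum_(om : {ffun 'I_d -> 'I_(onb_size KP ip)})
  f (updv (updv (fun j => b (om j)) i0 z) i1 y) *
  theta (f (updv (updv (fun j => b (om j)) i0 w) i1 v)).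

Definition gram_op z w y : V := riesz KP ip (fun v => theta (gram z y w v)).

(* F(z,w;u) for the derivation R_{z,w} = [gram_op z w]; [centro u] is F_u and
   [centro_adj u] its adjoint. *)
Definition derived z w u : K := \sum_j f (updv u j (gram_op z w (u j))).

Definition centro u z : V := riesz KP ip (fun w => theta (derived z w u)).

Definition centro_adj u w : V := riesz KP ip (fun z => derived z w u).

Definition in_centroid (A : V -> V) :=
  forall x j, f (updv x i0 (A (x i0))) = f (updv x j (A (x j))).

(** The first two conditions have degree 4 in [f], the others degree 3. On a single block R_{z,w}
    is, up to a factor, the map sending y to <z,w> y - <y,w> z; [altc_gram] records this in terms of
    [derived]. For real scalars [altc_real] makes the operators self-adjoint. *)
Record alt_conditions : Prop := AltConditions {
  altc_centro : forall u, in_centroid (centro u);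
  altc_adj : forall u, in_centroid (centro_adj u);
  altc_gram : forall z w u j, d.-1%:R * f (updv u j (gram_op z w (u j))) =
    derived z w u - derived (u j) w (updv u j z);
  altc_real : theta =1 id -> forall u z, centro u z = centro_adj u z }.

Hypothesis f_lin : @multilinear _ _ (fun=> V) f.

Hypothesis i10 : i1 != i0.

Lemma gram_linear1 w v y : scalar (fun z => gram z y w v).
Proof.
move=> a z z'; rewrite /gram mulr_sumr -big_split /=; apply: eq_bigr => om _.
have e z0 : updv (updv (fun j => b (om j)) i0 z0) i1 y =
            updv (updv (fun j => b (om j)) i1 y) i0 z0 by rewrite updC 1?eq_sym.
by rewrite !e f_lin mulrDl mulrA.
Qed.

Lemma gram_linear2 z w v : scalar (fun y => gram z y w v).
Proof.
move=> a y y'; rewrite /gram mulr_sumr -big_split /=; apply: eq_bigr => om _.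
by rewrite f_lin mulrDl mulrA.
Qed.

Lemma gramC z y w v : gram z y w v = theta (gram w v z y).
Proof.
rewrite rmorph_sum; apply: eq_bigr => om _.
by rewrite rmorphM /= (conjgK KP) mulrC.
Qed.

Lemma ip_gram_op z w y v : ip (gram_op z w y) v = gram z y w v.
Proof.
rewrite ipC rieszP ?(conjgK KP) // => a v1 v2.
by rewrite -!gramC gram_linear2.
Qed.

Lemma gram_op_linear z w a y y' :
  gram_op z w (a *: y + y') = a *: gram_op z w y + gram_op z w y'.
Proof.
apply: (ip_ext (ip := ip)) => v.
by rewrite ipDl ipZl !ip_gram_op gram_linear2.
Qed.

Lemma gram_op_linear1 w y a z z' :
  gram_op (a *: z + z') w y = a *: gram_op z w y + gram_op z' w y.
Proof.
apply: (ip_ext (ip := ip)) => v.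
by rewrite ipDl ipZl !ip_gram_op gram_linear1.
Qed.

Lemma gram_op_semilinear z y a w w' :
  gram_op z (a *: w + w') y = theta a *: gram_op z w y + gram_op z w' y.
Proof.
apply: (ip_ext (ip := ip)) => v; rewrite ipDl ipZl !ip_gram_op.
by rewrite gramC gram_linear1 rmorphD rmorphM -!gramC.
Qed.

Lemma derived_linear w u : scalar (fun z => derived z w u).
Proof.
move=> a z z'; rewrite /derived mulr_sumr -big_split; apply: eq_bigr => j _ /=.
by rewrite gram_op_linear1 f_lin.
Qed.

Lemma derived_semilinear z u a w w' :
  derived z (a *: w + w') u = theta a * derived z w u + derived z w' u.
Proof.
rewrite /derived mulr_sumr -big_split; apply: eq_bigr => j _ /=.
by rewrite gram_op_semilinear f_lin.
Qed.

Lemma derived_multilinear z w : @multilinear _ _ (fun=> V) (derived z w).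
Proof.
apply: multilinear_bigsum => j.
exact: (multilinear_slot (j := j) f_lin (gram_op_linear z w)).
Qed.

Lemma ip_centro u z w : ip (centro u z) w = derived z w u.
Proof.
rewrite ipC rieszP ?(conjgK KP) // => a w1 w2.
by rewrite derived_semilinear rmorphD rmorphM /= (conjgK KP).
Qed.

Lemma ip_centro_adj u z w : ip z (centro_adj u w) = derived z w u.
Proof. by rewrite rieszP //; apply: derived_linear. Qed.

Hypothesis f_alt : forall (s : 'S_d) x, f (fun j => x (s j)) = (-1) ^+ s * f x.

Variable i2 : 'I_d.
Hypothesis i20 : i2 != i0.
Hypothesis i21 : i2 != i1.

(** The radical of [f]; for an alternating form one slot decides. *)
Definition alt_rad v := forall x, f (updv x i0 v) = 0.

Lemma alt_rad_slot v : alt_rad v -> forall x j, f (updv x j v) = 0.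
Proof.
move=> rv x j; pose s := tperm i0 j.
have -> : updv x j v = (fun k => updv (fun k => x (s k)) i0 v (s k)).
  apply: functional_extensionality_dep => k; case: (eqVneq k j) => [->|kj].
    by rewrite tpermR !upd_same.
  rewrite !upd_neq ?tpermK //; apply: contra kj => /eqP e.
  by rewrite -(tpermK i0 j k) e tpermL.
by rewrite f_alt rv mulr0.
Qed.

Lemma gram_rad1 z y w v : alt_rad z -> gram z y w v = 0.
Proof.
move=> rz; rewrite /gram big1 // => om _.
by rewrite updC 1?eq_sym // alt_rad_slot // mul0r.
Qed.

Lemma gram_rad3 z y w v : alt_rad w -> gram z y w v = 0.
Proof. by move=> rw; rewrite gramC gram_rad1 ?rmorph0. Qed.

Lemma gram_rad4 z y w v : alt_rad v -> gram z y w v = 0.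
Proof.
move=> rv; rewrite /gram big1 // => om _.
by rewrite (alt_rad_slot rv) rmorph0 mulr0.
Qed.

Lemma derived_rad1 z w u : alt_rad z -> derived z w u = 0.
Proof.
move=> rz; rewrite /derived big1 // => j _.
have -> : gram_op z w (u j) = 0.
  by apply: (ip_ext (ip := ip)) => v; rewrite ip_gram_op gram_rad1 // ip0l.
exact: (multilinear0 _ _ f_lin).
Qed.

Lemma derived_rad2 z w u : alt_rad w -> derived z w u = 0.
Proof.
move=> rw; rewrite /derived big1 // => j _.
have -> : gram_op z w (u j) = 0.
  by apply: (ip_ext (ip := ip)) => v; rewrite ip_gram_op gram_rad3 // ip0l.
exact: (multilinear0 _ _ f_lin).
Qed.

(** The operators [A] and [B] are moved away from [y] into the distinct slots [i1] and [i2], where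
    their order is immaterial. *)
Lemma centroid_commute A B : in_centroid A -> in_centroid B ->
  forall y, alt_rad (A (B y) - B (A y)).
Proof.
move=> cA cB y x; rewrite (multilinearB _ _ _ f_lin); apply/eqP; rewrite subr_eq0.
apply/eqP; have i01 : i0 != i1 by rewrite eq_sym.
have i02 : i0 != i2 by rewrite eq_sym.
have i12 : i1 != i2 by rewrite eq_sym.
have := cA (updv x i0 (B y)) i1; rewrite upd_same upd_upd upd_neq // => ->.
rewrite (updC x (j := i0) (k := i1) _ _ i01).
have := cB (updv (updv x i1 (A (x i1))) i0 y) i2.
rewrite upd_same upd_upd upd_neq // upd_neq // => ->.
have := cB (updv x i0 (A y)) i2; rewrite upd_same upd_upd upd_neq // => ->.
rewrite (updC x (j := i0) (k := i2) _ _ i02).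
have := cA (updv (updv x i2 (B (x i2))) i0 y) i1.
rewrite upd_same upd_upd upd_neq // upd_neq // => ->.
congr (f _); rewrite (updC _ (j := i0) (k := i2) _ _ i02).
rewrite (updC _ (j := i0) (k := i1) _ _ i01).
by rewrite (updC x (j := i1) (k := i2) _ _ i12).
Qed.

Lemma f_eq0_noninjective n (e : 'I_n -> V) (om : 'I_d -> 'I_n) :
  f (fun j => e (om j)) != 0 -> injective om.
Proof.
move=> nz j l ojl; apply/eqP; apply: contraNT nz => jl.
have := f_alt (tperm j l) (fun j => e (om j)).
rewrite odd_tperm jl expr1 mulN1r => /eqP.
rewrite (_ : (fun j0 => _) = (fun j => e (om j))).
  by rewrite -addr_eq0 -mulr2n mulrn_eq0.
apply: functional_extensionality_dep => k.
by case: tpermP => [->|->|//]; rewrite ojl.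
Qed.

Hypothesis fC : alt_conditions.

(** The operators [centro u] and their adjoints commute: a commutator has values in the radical,
    while the images of the operators are orthogonal to the radical. So the spectral theorem
    applies. *)
Lemma centro_eigenbasis : exists n (e : 'I_n -> V), orthonormal_basis ip e /\
  exists phi : 'I_n -> ('I_d -> V) -> K, [/\
    forall k u, centro u (e k) = phi k u *: e k &
    forall k u y, derived y (e k) u = phi k u * ip y (e k)].
Proof.
(* The boolean selects an operator or its adjoint, so that the family is closed under adjoints. *)
have HA (i : bool * ('I_d -> V)) : exists A : 'End(V),
    forall z, A z = (if i.1 then centro i.2 else centro_adj i.2) z.
  case: i => [[] u] /=; apply: ex_lfun => a y z; apply: (ip_ext (ip := ip)) => w.
    by rewrite ipDl ipZl !ip_centro derived_linear.
  rewrite [LHS]ipC [RHS]ipC; congr (theta _).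
  by rewrite ipDr ipZr !ip_centro_adj derived_semilinear.
pose A i := sval (cid (HA i)).
have AE i z : A i z = (if i.1 then centro i.2 else centro_adj i.2) z.
  by rewrite /A; case: cid.
have adj i y z : ip (A i y) z = ip y (A (~~ i.1, i.2) z).
  rewrite !AE; case: i => [[] u] /=; first by rewrite ip_centro ip_centro_adj.
  by rewrite ipC ip_centro_adj -ip_centro -ipC.
have A_cent i : in_centroid (A i).
  by move=> x j; rewrite !AE; case: i => [[] u] /=;
    [apply: altc_centro | apply: altc_adj].
have A_rad i y v : alt_rad v -> ip (A i y) v = 0.
  move=> rv; rewrite AE; case: i => [[] u] /=.
    by rewrite ip_centro derived_rad2.
  by rewrite ipC ip_centro_adj derived_rad1 ?rmorph0.
case: (@spectral_basis _ _ KP V ip _ A) => [i|i j y|th i y z|n [e [eP ee]]].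
- by exists (~~ i.1, i.2) => y z; apply: adj.
- apply/eqP; rewrite -subr_eq0 -(ip_eq0 ip).
  have rD := centroid_commute (A_cent i) (A_cent j) y.
  by rewrite ipBl !A_rad // subrr.
- rewrite adj !AE; case: i => [[] u] /=; first by rewrite altc_real.
  by rewrite altc_real.
exists n, e; split=> //; exists (fun k u => derived (e k) (e k) u).
split=> [k u|k u y].
  have [l] := ee (true, u) k; rewrite AE /= => hl.
  by rewrite -ip_centro hl ipZl eP.1 eqxx mulr1.
have [l] := ee (false, u) k; rewrite AE /= => hl.
by rewrite -!ip_centro_adj hl !ipZr eP.1 eqxx mulr1.
Qed.

(** * Blocks of equal joint eigenvalues *)

Section Blocks.
Variables (n : nat) (e : 'I_n -> V) (phi : 'I_n -> ('I_d -> V) -> K).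
Hypothesis eP : orthonormal_basis ip e.
Hypothesis phi_eigen : forall k u, centro u (e k) = phi k u *: e k.
Hypothesis phi_adj : forall k u y, derived y (e k) u = phi k u * ip y (e k).

Lemma phiE k u : phi k u = derived (e k) (e k) u.
Proof. by rewrite phi_adj eP.1 eqxx mulr1. Qed.

Lemma d1_neq0 : d.-1%:R != 0 :> K.
Proof.
rewrite pnatr_eq0; have: (1 < d)%N; last by case: (d) => [|[]].
rewrite -[d]card_ord; apply/card_gt1P; by exists i0, i1; rewrite // eq_sym.
Qed.

(** For z = w = [e k], condition [altc_gram] puts the values of [N] into the radical, to which they
    are also orthogonal; so [N] is zero. Then [ip (N y) y] is a vanishing sum of terms a * theta a,
    with a running over values of [f] at tuples that start with [e k] and [y]. *)
Lemma phi0_rad k : (forall u, phi k u = 0) -> alt_rad (e k).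
Proof.
move=> phi0; pose N y := gram_op (e k) (e k) y.
have radN y : alt_rad (N y).
  move=> x; apply: (mulfI d1_neq0); rewrite mulr0.
  have := altc_gram fC (e k) (e k) (updv x i0 y) i0.
  by rewrite upd_same !upd_upd !phi_adj !phi0 !mul0r subrr.
have N0 y : N y = 0.
  by apply/eqP; rewrite -(ip_eq0 ip) ip_gram_op gram_rad4.
have f0 om y : f (updv (updv (fun j => b (om j)) i0 (e k)) i1 y) = 0.
  have /eqP : gram (e k) y (e k) y = 0 by rewrite -ip_gram_op -/(N y) N0 ip0l.
  rewrite psumr_eq0 => [|om' _]; last exact: (mulconj_ge0 KP).
  move=> /allP/(_ [ffun j => om j]); rewrite mem_index_enum => /(_ isT) /=.
  rewrite mulf_eq0 fmorph_eq0 orbb (_ : (fun j => _) = (fun j => b (om j))).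
    by move/eqP.
  by apply: functional_extensionality_dep => j; rewrite ffunE.
(* The entry in slot [i0] is projected to the line of [e k]; the result is multilinear in all slots
   and can be tested on basis tuples. *)
pose g x := ip (x i0) (e k) * f (updv x i0 (e k)).
have gl : @multilinear _ _ (fun=> V) g.
  pose P y := ip y (e k) *: e k.
  have <- : (fun x => f (updv x i0 (P (x i0)))) = g.
    by apply: functional_extensionality_dep => x; apply: (multilinearZ _ _ _ f_lin).
  apply: (multilinear_slot (j := i0) (A := P) f_lin) => a y z.
  by rewrite /P ipDl ipZl scalerDl scalerA.
move=> x; suff : g (updv x i0 (e k)) = 0.
  by rewrite /g upd_same upd_upd eP.1 eqxx mul1r.
apply: (@multilinear_basis_ext _ _ d (fun=> V) (fun=> ip) g
  (fun=> 0) (fun=> onb_size KP ip) (fun=> b) (fun=> onbP KP ip) gl).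
  by move=> ? ? ? ? ? /=; rewrite mulr0 addr0.
by move=> om; rewrite /g -[updv _ i0 _](upd_id _ i1) f0 mulr0.
Qed.

(** A centroid operator has the same effect in slot [j] as in slot [i0], so at a tuple of
    eigenvectors where [f] is nonzero the eigenvalues agree. *)
Lemma phi_block (om : 'I_d -> 'I_n) : f (fun j => e (om j)) != 0 ->
  forall j u, phi (om j) u = phi (om i0) u.
Proof.
move=> nz j u; apply: (mulIf nz).
have := altc_centro fC u (fun j => e (om j)) j.
rewrite !phi_eigen !(multilinearZ _ _ _ f_lin).
by rewrite (upd_id (fun j => e (om j)) i0) (upd_id (fun j => e (om j)) j).
Qed.

(* Summing [altc_gram] over all slots recovers the derivation of f by the Gram
   operator of e k on the left. *)
Lemma phi_cramer k u :
  phi k u = \sum_j ip (u j) (e k) * phi k (updv u j (e k)).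
Proof.
have e1 : d.-1%:R * phi k u = d%:R * phi k u -
    \sum_j ip (u j) (e k) * phi k (updv u j (e k)).
  have -> : d%:R * phi k u = \sum_(j < d) phi k u.
    by rewrite sumr_const card_ord mulr_natl.
  rewrite {1}phiE /derived mulr_sumr -sumrB; apply: eq_bigr => j _.
  by rewrite (altc_gram fC) -phiE phi_adj [_ * ip _ _]mulrC.
have d1 : d%:R = d.-1%:R + 1 :> K by rewrite natr1 prednK // (leq_trans _ (ltn_ord i0)).
by move: e1; rewrite d1 mulrDl mul1r -addrA => /(congr1 (+%R^~ (- (d.-1%:R * phi k u))));
  rewrite subrr addrAC subrr add0r => /esym/eqP; rewrite subr_eq0 => /eqP.
Qed.

Definition block k := [set k' | `[< forall u, phi k' u = phi k u >]].

(** The form [phi k] is not zero, so it is nonzero at some basis tuple [om]. For [k'] in the block,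
    [phi_cramer] then forces [k'] to be an entry of [om], which has d entries. *)
Lemma block_card k : ~ alt_rad (e k) -> (#|block k| <= d)%N.
Proof.
move=> nr; have [om hom] : exists om : 'I_d -> 'I_n, phi k (fun j => e (om j)) != 0.
  apply/not_existsP => h; apply: nr; apply: phi0_rad => u; rewrite phiE.
  apply: (@multilinear_basis_ext _ _ d (fun=> V) (fun=> ip) (derived (e k) (e k))
    (fun=> 0) (fun=> n) (fun=> e) (fun=> eP)).
  - exact: derived_multilinear.
  - by move=> ? ? ? ? ? /=; rewrite mulr0 addr0.
  by move=> om; rewrite -phiE; apply/eqP/negPn/negP; apply: h.
rewrite -[d]card_ord -cardsT.
apply: leq_trans (leq_imset_card om _); apply: subset_leq_card.
apply/subsetP => k'; rewrite inE => /asboolP hk'; apply/imsetP.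
apply/exists2P; apply: contrapT => /forallNP h.
move: hom; rewrite -hk' phi_cramer big1 ?eqxx // => j _.
by rewrite eP.1; case: eqP => [ok|_]; rewrite ?mul0r //; case: (h j).
Qed.

(** The image lies in one block and has d elements since [om] is injective, while the block has at
    most d. *)
Lemma block_image (om : 'I_d -> 'I_n) : f (fun j => e (om j)) != 0 ->
  forall j, om @: setT = block (om j).
Proof.
move=> nz j; apply/eqP; rewrite eqEcard; apply/andP; split.
  apply/subsetP => _ /imsetP[l _ ->]; rewrite inE; apply/asboolP => u.
  by rewrite (phi_block nz) (phi_block nz j).
rewrite card_imset; last exact: f_eq0_noninjective nz.
rewrite cardsT card_ord; apply: block_card => re; case/negP: nz.
by rewrite -(upd_id (V := fun=> V) (fun j => e (om j)) j) alt_rad_slot.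
Qed.

End Blocks.

(** The index sets of basis tuples with nonzero value are blocks, hence equal or disjoint. Each
    contributes one wedge of basis vectors, scaled by a value of [f], and the equality is checked on
    basis tuples. *)
Lemma alt_conditions_decomposition : exists (k : nat) (a : 'I_k -> 'I_d -> V),
  orthogonal_family ip (fun p : 'I_k * 'I_d => a p.1 p.2) /\
  forall x, f x = \sum_i \sum_(s : 'S_d) (-1) ^+ s * \prod_j ip (x j) (a i (s j)).
Proof.
have [n [e [eP [phi [ph1 ph2]]]]] := centro_eigenbasis.
have blockE := block_image eP ph1 ph2.
pose S := [set B : {set 'I_n} | [exists om : {ffun 'I_d -> 'I_n},
  (f (fun j => e (om j)) != 0) && (om @: setT == B)]].
have ex_om (i : 'I_#|S|) : exists om : 'I_d -> 'I_n,
    f (fun j => e (om j)) != 0 /\ om @: setT = enum_val i.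
  have := enum_valP i; rewrite inE => /existsP[om /andP[h1 /eqP h2]].
  by exists om.
pose om i := sval (cid (ex_om i)).
have om_nz i : f (fun j => e (om i j)) != 0 by rewrite /om; case: cid => ? [].
have om_im i : om i @: setT = enum_val i by rewrite /om; case: cid => ? [].
have om_inj i : injective (om i) by apply: f_eq0_noninjective (om_nz i).
have om_disj i i' j j' : om i j = om i' j' -> i = i'.
  move=> h; apply: enum_val_inj; rewrite -!om_im (blockE _ (om_nz i) j).
  by rewrite (blockE _ (om_nz i') j') h.
pose c i := f (fun j => e (om i j)).
pose a i j := (if j == i0 then theta (c i) else 1) *: e (om i j).
exists #|S|, a; split.
  split=> [[i j]|[i j] [i' j'] ne]; rewrite /a /=.
    rewrite scaler_eq0 negb_or -[e _ == 0](ip_eq0 ip) eP.1 eqxx oner_eq0 andbT.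
    by case: ifP => _; rewrite ?oner_eq0 ?fmorph_eq0 //; apply: om_nz.
  rewrite ipZl ipZr eP.1 (negPf (_ : om i j != om i' j')) ?mulr0 //.
  apply: contra ne => /eqP h; have ii' := om_disj _ _ _ _ h; subst i'.
  by rewrite (om_inj _ _ _ h) eqxx.
have termE i (s : 'S_d) x : \prod_j ip (x j) (a i (s j)) =
    c i * \prod_j ip (x j) (e (om i (s j))).
  rewrite /a; under eq_bigr => j _ do rewrite ipZr.
  (* The vector carrying the scalar occurs once in the product, at the position that [s] sends to
     [i0]. *)
  rewrite big_split /= (bigD1 (s^-1 i0)%g) //= permKV eqxx (conjgK KP).
  rewrite [X in _ * X * _]big1 ?mulr1 // => j js.
  by rewrite -[j](permK s) (can_eq (permKV s)) in js; rewrite (negPf js) rmorph1.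
apply: (@multilinear_basis_ext _ _ d (fun=> V) (fun=> ip) f _
  (fun=> n) (fun=> e) (fun=> eP) f_lin).
  apply: multilinear_bigsum => i; apply: multilinear_bigsum => s.
  apply: multilinear_scale.
  exact: (multilinear_prod (fun j => @ip_scalar _ _ _ ip (a i (s j)))).
move=> w; under eq_bigr => i _ do under eq_bigr => s _ do rewrite termE.
have f_om i (s : 'S_d) : f (fun j => e (om i (s j))) = (-1) ^+ s * c i.
  exact: (f_alt s (fun j => e (om i j))).
have prod0 i (s : 'S_d) : (exists j, w j <> om i (s j)) ->
    \prod_j ip (e (w j)) (e (om i (s j))) = 0.
  move=> [j /eqP hj]; rewrite (bigD1 j) //= eP.1 (negPf hj) mul0r //.
have w_eq i (s : 'S_d) : ~ (exists j, w j <> om i (s j)) -> w = fun j => om i (s j).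
  move=> h; apply: functional_extensionality_dep => j; apply: contrapT => hj.
  by apply: h; exists j.
(* Where [f] vanishes, [w] rearranges no [om i], since there [f] would take the value [c i] up to
   sign. *)
have [fw0|fwn0] := eqVneq (f (fun j => e (w j))) 0.
  rewrite fw0 big1 // => i _; rewrite big1 // => s _.
  rewrite prod0 ?mulr0 //; apply: contrapT => /w_eq we.
  move/eqP: fw0; rewrite we f_om mulf_eq0 signr_eq0 /=.
  by rewrite (negPf (om_nz i)).
(* Otherwise the image of [w] is a block, [w] is the rearrangement of its [om i] by a unique
   permutation [s], and a single term survives. *)
have wS : w @: setT \in S.
  rewrite inE; apply/existsP; exists [ffun j => w j]; apply/andP; split.
    rewrite (_ : (fun j => _) = (fun j => e (w j))) //.
    by apply: functional_extensionality_dep => j; rewrite ffunE.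
  by apply/eqP/eq_imset => j; rewrite ffunE.
pose i := enum_rank_in wS (w @: setT).
have iE : om i @: setT = w @: setT by rewrite om_im enum_rankK_in.
have ex_s j : exists l, om i l = w j.
  have : w j \in om i @: setT by rewrite iE imset_f.
  by case/imsetP => l _ ->; exists l.
pose s0 j := sval (cid (ex_s j)).
have s0E j : om i (s0 j) = w j by rewrite /s0; case: cid.
have s0_inj : injective s0.
  move=> j l h; apply: (f_eq0_noninjective fwn0).
  by rewrite -!s0E h.
pose s := perm s0_inj.
have ws j : w j = om i (s j) by rewrite permE s0E.
rewrite (bigD1 i) //= [X in _ + X]big1 ?addr0; last first.
  move=> i' ii'; rewrite big1 // => t _.
  rewrite prod0 ?mulr0 //; exists i0; rewrite ws => /om_disj e'.
  by rewrite e' eqxx in ii'.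
rewrite (bigD1 s) //= [X in _ + X]big1 ?addr0; last first.
  move=> t ts; rewrite prod0 ?mulr0 //; apply: contrapT => /w_eq we.
  case/negP: ts; apply/eqP/permP => j; apply: (om_inj i).
  by rewrite -ws we.
rewrite [X in _ * (_ * X)]big1 ?mulr1 -?f_om; last first.
  by move=> j _; rewrite ws eP.1 eqxx.
by congr f; apply: functional_extensionality_dep => j; rewrite ws.
Qed.

End AlternatingForm.

(** * Permutations and determinants *)

Lemma perm_fix_off1 (T : finType) (c : T) (r : {perm T}) :
  (forall j, j != c -> r j = j) -> r = 1%g.
Proof.
move=> rj; apply/permP => j; rewrite perm1; case: (eqVneq j c) => [->|/rj//].
by apply/eqP; apply: contraT => rc; case/eqP: (rc); apply/perm_inj/rj.
Qed.

Lemma perm_agree_off2 (T : finType) (i0 i1 : T) (s t : {perm T}) :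
  (forall j, j != i0 -> j != i1 -> t j = s j) -> t = s \/ t = (tperm i0 i1 * s)%g.
Proof.
move=> ts; pose r := (t * s^-1)%g.
have rj j : j != i0 -> j != i1 -> r j = j.
  by move=> j0 j1; rewrite permM ts // permK.
have tE : t = (r * s)%g by rewrite mulgKV.
case: (eqVneq (r i0) i0) => [r0|r0]; [left|right].
  rewrite tE (@perm_fix_off1 _ i1 r) ?mul1g // => j j1.
  by case: (eqVneq j i0) => [->//|j0]; apply: rj.
have r01 : r i0 = i1.
  by apply/eqP; apply: contraT => r1; case/eqP: (r0); apply/perm_inj/rj.
have q1 : (tperm i0 i1 * r)%g = 1%g.
  apply: (@perm_fix_off1 _ i0) => j j0; rewrite permM.
  case: (eqVneq j i1) => [->|j1]; first by rewrite tpermR.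
  by rewrite tpermD 1?eq_sym //; apply: rj.
by rewrite tE -[r](mulKg (tperm i0 i1)) q1 mulg1 tpermV.
Qed.

(** By right translation, every ordered pair of distinct values is attained at [i0], [i1] by the
    same number of permutations; this number is [c]. *)
Lemma sum_perm_pair (K : pzRingType) (d : nat) (i0 i1 : 'I_d) : i1 != i0 ->
  exists c : K, forall q : 'I_d -> 'I_d -> K, (forall j, q j j = 0) ->
    \sum_(s : 'S_d) q (s i0) (s i1) = c * \sum_j \sum_l q j l.
Proof.
move=> i10; pose N j l := #|[set s : 'S_d | (s i0 == j) && (s i1 == l)]|.
exists (N i0 i1)%:R => q q0.
have NE j l : j != l -> N j l = N i0 i1.
  move=> jl; pose p := (tperm i0 j * tperm (tperm i0 j i1) l)%g.
  have tj : tperm i0 j i1 != j.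
    by rewrite -{2}(tpermL i0 j) (inj_eq perm_inj).
  have p0 : p i0 = j by rewrite permM tpermL tpermD // eq_sym.
  have p1 : p i1 = l by rewrite permM tpermL.
  rewrite /N -[RHS](card_imset _ (mulIg p)); apply: eq_card => s; rewrite inE.
  move: p p0 p1 => p p0 p1.
  apply/idP/imsetP => [/andP[/eqP s0 /eqP s1]|[t + ->]].
    exists (s * p^-1)%g; last by rewrite mulgKV.
    by rewrite inE !permM s0 s1 -p0 -p1 !permK !eqxx.
  by rewrite inE => /andP[/eqP t0 /eqP t1]; rewrite !permM t0 t1 p0 p1 !eqxx.
rewrite (partition_big (fun s : 'S_d => s i0) predT) //= mulr_sumr.
apply: eq_bigr => j _.
rewrite (partition_big (fun s : 'S_d => s i1) predT) //= mulr_sumr.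
apply: eq_bigr => l _; case: (eqVneq j l) => [<-|jl].
  by rewrite q0 mulr0 big1 // => s /andP[/eqP -> /eqP ->].
rewrite (eq_bigr (fun=> q j l)) => [|s /andP[/eqP -> /eqP ->]] //.
by rewrite sumr_const -(NE j l jl) mulr_natl /N cardsE.
Qed.

(** Cramer's rule: expansion along the replaced row produces the adjugate, and the adjugate times
    [A] is scalar. *)
Lemma det_upd_row (K : comPzRingType) (d : nat) (A : 'M[K]_d) (z : 'I_d -> K) c :
  \sum_j A j c * \det (\matrix_(i, l) if i == j then z l else A i l) =
  z c * \det A.
Proof.
have e j : \det (\matrix_(i, l) if i == j then z l else A i l) =
    \sum_l z l * \adj A l j.
  rewrite (expand_det_row _ j); apply: eq_bigr => l _; rewrite !mxE eqxx.
  rewrite /cofactor; congr (_ * (_ * \det _)).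
  by apply/matrixP => p q; rewrite !mxE eq_sym (negPf (neq_lift _ _)).
under eq_bigr => j _ do rewrite e mulr_sumr.
rewrite exchange_big /=.
transitivity (\sum_l z l * (\adj A *m A) l c).
  apply: eq_bigr => l _; rewrite mxE mulr_sumr; apply: eq_bigr => j _.
  by rewrite mulrCA [A j c * _]mulrC.
rewrite mul_adj_mx (bigD1 c) //= big1 ?addr0 ?mxE ?eqxx ?mulr1n // => l lc.
by rewrite mxE (negPf lc) mulr0n mulr0.
Qed.

(** * The alternating conditions for orthogonal sums of wedges *)

Section AlternatingForward.
Variables (K : numFieldType) (theta : {rmorphism K -> K}).
Hypothesis KP : scalar_field theta.
Variables (d : nat) (V : vectType K) (ip : {dot V for theta}).
Variables (i0 i1 i2 : 'I_d).
Hypothesis i10 : i1 != i0.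
Hypothesis i20 : i2 != i0.
Hypothesis i21 : i2 != i1.
Variables (k : nat) (a : 'I_k -> 'I_d -> V).
Hypothesis a_orth : orthogonal_family ip (fun p : 'I_k * 'I_d => a p.1 p.2).
Variable f : ('I_d -> V) -> K.
Hypothesis fE : forall x,
  f x = \sum_i \sum_(s : 'S_d) (-1) ^+ s * \prod_j ip (x j) (a i (s j)).

Local Notation b := (onb KP ip).
Local Notation updv x j y := (@upd d (fun=> V) x j y).

Let N i j := ip (a i j) (a i j).

Let N_neq0 i j : N i j != 0.
Proof. by rewrite ip_eq0; apply: (a_orth.1 (i, j)). Qed.

Let conjN i j : theta (N i j) = N i j.
Proof. by rewrite /N -ipC. Qed.

Let a_ortho i j i' j' : (i, j) != (i', j') -> ip (a i j) (a i' j') = 0.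
Proof. by move/(a_orth.2). Qed.

Let fb i x := \sum_(s : 'S_d) (-1) ^+ s * \prod_j ip (x j) (a i (s j)).

(** The inner product of the projections of [z] and [w] to the span of the vectors [a i j], which
    need not have norm one. *)
Let h i z w := \sum_j ip z (a i j) * ip (a i j) w / N i j.

(** The orthogonal projection to that span. *)
Let P i z := \sum_j (ip z (a i j) / N i j) *: a i j.

Let ipP i z w : ip (P i z) w = h i z w.
Proof.
by rewrite /P ip_suml; apply: eq_bigr => j _; rewrite ipZl mulrAC.
Qed.

Let ipPr i z w : ip z (P i w) = h i z w.
Proof.
rewrite ipC ipP rmorph_sum; apply: eq_bigr => j _.
by rewrite !rmorphM /= fmorphV conjN -!ipC [ip _ _ * ip _ _]mulrC.
Qed.

Let ipPa i z l j : ip (P i z) (a l j) = if i == l then ip z (a i j) else 0.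
Proof.
rewrite ipP /h; case: eqP => [<-|/eqP il].
  rewrite (bigD1 j) //= mulfK; last exact: N_neq0.
  rewrite big1 ?addr0 // => m mj.
  by rewrite a_ortho ?mulr0 ?mul0r // xpair_eqE eqxx.
rewrite big1 // => m _; rewrite a_ortho ?mulr0 ?mul0r // xpair_eqE.
by rewrite (negPf il).
Qed.

Let fb_lin i : @multilinear _ _ (fun=> V) (fb i).
Proof.
apply: multilinear_bigsum => s; apply: multilinear_scale.
exact: (multilinear_prod (fun j => @ip_scalar _ _ _ ip (a i (s j)))).
Qed.

Let f_lin : @multilinear _ _ (fun=> V) f.
Proof.
have -> : f = fun x => \sum_i fb i x by apply/funext.
exact: multilinear_bigsum.
Qed.

Let f_updP i x j y : f (updv x j (P i y)) = fb i (updv x j y).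
Proof.
rewrite fE (bigD1 i) //= [X in _ + X]big1 ?addr0 => [|l li]; last first.
  rewrite big1 // => s _; rewrite (bigD1 j) //= upd_same ipPa.
  by rewrite eq_sym (negPf li) mul0r mulr0.
apply: eq_bigr => s _; congr (_ * _); apply: eq_bigr => l _.
by case: (eqVneq l j) => [->|lj]; rewrite ?upd_same ?ipPa ?eqxx // !upd_neq.
Qed.

Let fb_det i x : fb i x = \det (\matrix_(j, l) ip (x j) (a i l)).
Proof.
apply: eq_bigr => s _; congr (_ * _); apply: eq_bigr => j _; by rewrite mxE.
Qed.

Let fb_cramer i x z w :
  \sum_j h i (x j) w * fb i (updv x j z) = h i z w * fb i x.
Proof.
pose A := \matrix_(j, l) ip (x j) (a i l).
have e j : fb i (updv x j z) =
    \det (\matrix_(m, l) if m == j then ip z (a i l) else A m l).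
  rewrite fb_det; congr (\det _); apply/matrixP => m l; rewrite !mxE.
  by case: eqP => [->|/eqP mj]; rewrite ?upd_same ?upd_neq.
under eq_bigr => j _ do rewrite e /h mulr_suml.
rewrite exchange_big /= fb_det -/A /h mulr_suml; apply: eq_bigr => c _.
transitivity (ip (a i c) w / N i c * (ip z (a i c) * \det A)); last by ring.
rewrite -(det_upd_row A (fun l => ip z (a i l)) c) mulr_sumr.
by apply: eq_bigr => j _; rewrite mxE; ring.
Qed.

Let contract i l x y :
  \sum_o ip (b o) (a i x) * theta (ip (b o) (a l y)) = ip (a l y) (a i x).
Proof.
rewrite (parseval _ _ (onbP KP ip)); apply: eq_bigr => o _.
by rewrite -ipC mulrC [in RHS]mulrC -ipC mulrC.
Qed.

(** Expand both factors over blocks and permutations and sum over the basis. Each free slot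
    contracts two vectors [a], so the blocks agree and the permutations differ at most by exchanging
    [i0] and [i1]; the two possibilities give the two terms with opposite signs. *)
Lemma gram_blocks : exists g : 'I_k -> K, forall z y w v,
  gram KP ip i0 i1 f z y w v =
  \sum_i g i * (h i z w * h i y v - h i z v * h i y w).
Proof.
have [c hc] := sum_perm_pair K i10.
pose n := (onb_size KP ip)%:R : K.
(* The factor [n ^+ 2] comes from the idle basis sums in the two occupied slots, the product from
   the contractions, completed by the norms that [h] divides by, and [c] counts permutations. *)
exists (fun i => n ^+ 2 * (\prod_j N i j) * c) => z y w v.
pose Y z y j o := if j == i1 then y else if j == i0 then z else b o.
have YE z' y' (om : {ffun 'I_d -> 'I_(onb_size KP ip)}) :
    updv (updv (fun j => b (om j)) i0 z') i1 y' = fun j => Y z' y' j (om j).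
  apply: functional_extensionality_dep => j; rewrite /Y.
  case: (eqVneq j i1) => [->|j1]; first by rewrite upd_same.
  by rewrite upd_neq //; case: (eqVneq j i0) => [->|j0]; rewrite ?upd_same ?upd_neq.
pose E i l (s t : 'S_d) := n ^+ 2 *
  (ip z (a i (s i0)) * theta (ip w (a l (t i0)))) *
  (ip y (a i (s i1)) * theta (ip v (a l (t i1)))) *
  \prod_(j | (j != i0) && (j != i1)) ip (a l (t j)) (a i (s j)).
have EE i l (s t : 'S_d) : \sum_(om : {ffun 'I_d -> 'I_(onb_size KP ip)})
    (\prod_j ip (Y z y j (om j)) (a i (s j))) *
    theta (\prod_j ip (Y w v j (om j)) (a l (t j))) = E i l s t.
  under eq_bigr => om _ do rewrite rmorph_prod -big_split /=.
  rewrite -(bigA_distr_bigA (fun j o => ip (Y z y j o) (a i (s j)) *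
    theta (ip (Y w v j o) (a l (t j))))) /=.
  rewrite (bigD1 i0) //= (bigD1 i1) //= /Y !eqxx [i0 == i1]eq_sym (negPf i10).
  have cst (x : K) : \sum_(o < onb_size KP ip) x = n * x.
    by rewrite sumr_const card_ord mulr_natl.
  rewrite !cst /E.
  rewrite (eq_bigr (fun j => ip (a l (t j)) (a i (s j)))) => [|j /andP[/negPf j0 /negPf j1]].
    by rewrite [n ^+ 2]expr2; ring.
  by rewrite j0 j1 contract.
have -> : gram KP ip i0 i1 f z y w v =
    \sum_i \sum_l \sum_(s : 'S_d) \sum_(t : 'S_d) ((-1) ^+ s * (-1) ^+ t) * E i l s t.
  rewrite /gram; under eq_bigr => om _ do rewrite !YE !fE.
  under eq_bigr => om _.
    rewrite mulr_suml; under eq_bigr => i _.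
      rewrite rmorph_sum mulr_sumr; under eq_bigr => l _.
        rewrite mulr_suml; under eq_bigr => s _.
          rewrite rmorph_sum mulr_sumr.
          over.
        over.
      over.
    over.
  rewrite exchange_big; apply: eq_bigr => i _ /=.
  rewrite exchange_big; apply: eq_bigr => l _ /=.
  rewrite exchange_big; apply: eq_bigr => s _ /=.
  rewrite exchange_big; apply: eq_bigr => t _ /=.
  rewrite -EE mulr_sumr; apply: eq_bigr => om _.
  by rewrite rmorphM rmorph_sign mulrACA.
apply: eq_bigr => i _; rewrite (bigD1 i) //= [X in _ + X]big1 ?addr0; last first.
  move=> l li; rewrite big1 // => s _; rewrite big1 // => t _.
  rewrite /E (bigD1 i2) /= ?i20 ?i21 // a_ortho ?mul0r ?mulr0 //.
  by rewrite xpair_eqE (negPf li).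
(* The surviving pair of permutations combined; [q] vanishes for equal indices, as [sum_perm_pair]
   demands. *)
pose q j l := (ip z (a i j) * theta (ip w (a i j)) * (ip y (a i l) * theta (ip v (a i l)))
  - ip z (a i j) * theta (ip v (a i j)) * (ip y (a i l) * theta (ip w (a i l)))) /
  (N i j * N i l).
have q0 j : q j j = 0.
  rewrite /q (_ : _ - _ = 0) ?mul0r //; ring.
transitivity (\sum_(s : 'S_d) n ^+ 2 * (\prod_j N i j) * q (s i0) (s i1)).
  apply: eq_bigr => s _; pose s' := (tperm i0 i1 * s)%g.
  have s's : s' != s.
    apply/eqP => e; have := congr1 (fun p : 'S_d => p i0) e.
    by rewrite permM tpermL => /perm_inj/eqP; rewrite (negPf i10).
  rewrite (bigD1 s) //= (bigD1 s') //= [X in _ + (_ + X)]big1 ?addr0; last first.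
    move=> t /andP[ts ts'].
    have [j /andP[/andP[j0 j1] tj]] : exists j, (j != i0) && (j != i1) && (t j != s j).
      apply/existsP; apply: contraNT ts' => /existsPn hj.
      have agree j : j != i0 -> j != i1 -> t j = s j.
        by move=> j0 j1; have := hj j; rewrite j0 j1 /= negbK => /eqP.
      by case: (perm_agree_off2 agree) => et; rewrite et eqxx in ts *.
    rewrite /E (bigD1 j) /= ?j0 ?j1 // a_ortho ?mul0r ?mulr0 //.
    by rewrite xpair_eqE eqxx.
  rewrite /E /s' odd_permM odd_tperm eq_sym i10 /= signrN !permM tpermL tpermR.
  pose M := \prod_(j | (j != i0) && (j != i1)) N i (s j).
  have -> : \prod_(j | (j != i0) && (j != i1))
      ip (a i ((tperm i0 i1 * s)%g j)) (a i (s j)) = M.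
    by apply: eq_bigr => j /andP[j0 j1]; rewrite permM tpermD // eq_sym.
  rewrite (_ : \prod_(j | _) ip (a i (s j)) _ = M) //.
  have -> : \prod_j N i j = N i (s i0) * (N i (s i1) * M).
    by rewrite (reindex_inj (@perm_inj _ s)) (bigD1 i0) //= (bigD1 i1).
  rewrite mulrN mulrA -signr_addb addbb expr0 /q.
  field.
  by rewrite !N_neq0.
rewrite -mulr_sumr hc // mulrA; congr (_ * _).
rewrite /h !mulr_suml -sumrB; apply: eq_bigr => j _.
rewrite !mulr_sumr -sumrB; apply: eq_bigr => l _.
rewrite /q (ipC ip (a i j) w) (ipC ip (a i l) v) (ipC ip (a i j) v) (ipC ip (a i l) w).
field.
by rewrite !N_neq0.
Qed.

(** By [gram_blocks] and Cramer's rule, [derived z w] acts on each block form as a multiple of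
    [h i z w]. So [centro u] and its adjoint are combinations of the projections [P i], which lie in
    the centroid. *)
Lemma alt_conditions_blocks : alt_conditions KP ip i0 i1 f.
Proof.
have [g gE] := gram_blocks.
have opE z w y : gram_op KP ip i0 i1 f z w y =
    \sum_i g i *: (h i z w *: P i y - h i y w *: P i z).
  apply: (ip_ext (ip := ip)) => v; rewrite ip_gram_op // gE ip_suml.
  apply: eq_bigr => i _; rewrite ipZl ipBl !ipZl !ipP; congr (_ * (_ - _)).
  exact: mulrC.
have f_op z w x j : f (updv x j (gram_op KP ip i0 i1 f z w (x j))) =
    \sum_i g i * (h i z w * fb i x - h i (x j) w * fb i (updv x j z)).
  rewrite opE (multilinear_sum _ _ _ _ f_lin); apply: eq_bigr => i _.
  rewrite (multilinearZ _ _ _ f_lin) (multilinearB _ _ _ f_lin).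
  rewrite !(multilinearZ _ _ _ f_lin) !f_updP.
  by rewrite (upd_id (V := fun=> V) x j).
have d1 : d%:R = d.-1%:R + 1 :> K by rewrite natr1 prednK // (leq_trans _ (ltn_ord i0)).
have dE z w x : derived KP ip i0 i1 f z w x =
    d.-1%:R * \sum_i g i * h i z w * fb i x.
  rewrite /derived; under eq_bigr => j _ do rewrite f_op.
  rewrite exchange_big mulr_sumr /=; apply: eq_bigr => i _.
  (* The first term is counted d times and the second sums to one copy by Cramer's rule, hence
     [d.-1]. *)
  rewrite -mulr_sumr sumrB fb_cramer sumr_const card_ord -(mulr_natl _ d) d1; ring.
have cE u z : centro KP ip i0 i1 f u z =
    \sum_i (d.-1%:R * g i * fb i u) *: P i z.
  apply: (ip_ext (ip := ip)) => w; rewrite ip_centro // dE ip_suml mulr_sumr.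
  by apply: eq_bigr => i _; rewrite ipZl ipP; ring.
have caE u w : centro_adj KP ip i0 i1 f u w =
    \sum_i theta (d.-1%:R * g i * fb i u) *: P i w.
  apply: (ip_ext (ip := ip)) => z; rewrite [LHS]ipC [RHS]ipC; congr (theta _).
  rewrite ip_centro_adj // dE ip_sumr mulr_sumr.
  by apply: eq_bigr => i _; rewrite ipZr (conjgK KP) ipPr; ring.
have centP (c : 'I_k -> K) (A : V -> V) : (forall z, A z = \sum_i c i *: P i z) ->
    in_centroid i0 f A.
  move=> AE x j.
  have e l : f (updv x l (A (x l))) = \sum_i c i * fb i x.
    rewrite AE (multilinear_sum _ _ _ _ f_lin); apply: eq_bigr => i _.
    by rewrite (multilinearZ _ _ _ f_lin) f_updP (upd_id (V := fun=> V) x l).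
  by rewrite !e.
split=> [u|u|z w u j|th u z].
- exact: centP (cE u).
- exact: centP (caE u).
- rewrite f_op !dE -mulrBr -sumrB; congr (_ * _); apply: eq_bigr => i _; ring.
- by rewrite cE caE; apply: eq_bigr => i _; rewrite th.
Qed.

End AlternatingForward.

(** * Degrees of the alternating conditions *)

Section AlternatingPolynomials.
Variables (K : numFieldType) (theta : {rmorphism K -> K}).
Hypothesis KP : scalar_field theta.
Variables (d : nat) (V : vectType K) (ip : {dot V for theta}).
Variables (i0 i1 i2 : 'I_d).
Hypothesis i10 : i1 != i0.
Hypothesis i20 : i2 != i0.
Hypothesis i21 : i2 != i1.

Local Notation W := (subvs_of (Alt d V)).
Local Notation f w := (@form K theta d (fun=> V) (fun=> ip) (vsval (w : W))).
Local Notation updv x j y := (@upd d (fun=> V) x j y).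

Lemma form_alt (w : W) (s : 'S_d) x :
  f w (fun j => x (s j)) = (-1) ^+ s * f w x.
Proof.
by rewrite -form_tpermute (AltP _ (subvsP w)) formZ rmorph_sign.
Qed.

Lemma form_wedge (v : 'I_d -> V) x :
  @form K theta d (fun=> V) (fun=> ip) (wedge v) x =
  \sum_(s : 'S_d) (-1) ^+ s * \prod_j ip (x j) (v (s j)).
Proof.
rewrite form_sum; apply: eq_bigr => s _.
by rewrite formZ rmorph_sign form_tens.
Qed.

Lemma alt_deco_form (w : W) : alt_deco ip w <->
  exists (k : nat) (a : 'I_k -> 'I_d -> V),
    orthogonal_family ip (fun p : 'I_k * 'I_d => a p.1 p.2) /\
    forall x, f w x = \sum_i \sum_(s : 'S_d) (-1) ^+ s * \prod_j ip (x j) (a i (s j)).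
Proof.
split=> [[k [a [ao wE]]]|[k [a [ao fE]]]]; exists k, a; split=> //.
  by move=> x; rewrite wE form_sum; apply: eq_bigr => i _; rewrite form_wedge.
apply: (form_inj KP (ip := fun=> ip)) => x.
by rewrite fE form_sum; apply: eq_bigr => i _; rewrite form_wedge.
Qed.

Variable polyfun : nat -> (W -> K) -> Prop.
Hypothesis PF : polynomial_functions theta polyfun.

Let L_lin a (x y : W) : vsval (a *: x + y) = a *: vsval x + vsval y.
Proof. exact: linearP. Qed.

Let polyfun_f x : polyfun 1 (fun w => f w x).
Proof. exact: (polyfun_form KP (fun=> ip) L_lin PF). Qed.

Let polyfun_fupd n j x (y : W -> V) : vpolyfun polyfun ip n y ->
  polyfun n.+1 (fun w => f w (updv x j (y w))).
Proof. exact: (polyfun_upd KP (ip := fun=> ip) L_lin PF (j := j)). Qed.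

Let f_lin w : @multilinear _ _ (fun=> V) (f w).
Proof. exact: form_multilinear. Qed.

Lemma vpolyfun_gram_op z w' y :
  vpolyfun polyfun ip 2 (fun w => gram_op KP ip i0 i1 (f w) z w' y).
Proof.
move=> v; apply: (@eq_polyfun _ _ _ _ (fun w => gram KP ip i0 i1 (f w) z y w' v)).
  by move=> w; rewrite ip_gram_op.
apply: (polyfun_sum PF) => om; apply: (polyfunM PF (m := 1) (n := 1)) => //.
exact: (polyfun_conj PF).
Qed.

Lemma polyfun_derived z w' u :
  polyfun 3 (fun w => derived KP ip i0 i1 (f w) z w' u).
Proof.
apply: (polyfun_sum PF) => j.
exact/polyfun_fupd/vpolyfun_gram_op.
Qed.

Lemma vpolyfun_centro u z :
  vpolyfun polyfun ip 3 (fun w => centro KP ip i0 i1 (f w) u z).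
Proof.
move=> v; apply: (eq_polyfun _ (polyfun_derived z v u)) => w.
by rewrite ip_centro.
Qed.

Lemma vpolyfun_centro_adj u y :
  vpolyfun polyfun ip 3 (fun w => centro_adj KP ip i0 i1 (f w) u y).
Proof.
move=> v; apply: (eq_polyfun _ (polyfun_conj PF (polyfun_derived v y u))) => w.
by rewrite [RHS]ipC ip_centro_adj.
Qed.

(** The zero form is an empty sum. A nonzero one inherits [alt_conditions] from the decomposable
    tensors, each condition being of degree 4 directly or after multiplication by a linear
    function. *)
Lemma alt_deco_polynomials w :
  (forall F, polyfun 4 F -> (forall w', alt_deco ip w' -> F w' = 0) -> F w = 0) ->
  alt_deco ip w.
Proof.
move=> hw; apply/alt_deco_form.
case: (pselect (forall x, f w x = 0)) => [f0|/existsNP[x0 /eqP fx0]].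
  exists 0, (fun _ _ => 0); split=> [|x]; last by rewrite f0 big_ord0.
  by split=> [[[]]|[[]]].
suff fC : alt_conditions KP ip i0 i1 (f w).
  by apply: (alt_conditions_decomposition (f_lin w) i10 (form_alt w) i20 i21 fC).
have XC w' : alt_deco ip w' -> alt_conditions KP ip i0 i1 (f w').
  by move=> /alt_deco_form[k [a [ao fE]]]; exact: (alt_conditions_blocks KP i10 i20 i21 ao fE).
have hw4 (F G : W -> K) : polyfun 4 F -> polyfun 4 G ->
    (forall w', alt_deco ip w' -> F w' = G w') -> F w = G w.
  move=> pF pG FG; apply/eqP; rewrite -subr_eq0; apply/eqP.
  apply: (hw (fun w => F w - G w)); first exact: (polyfunB PF).
  by move=> w' /FG ->; rewrite subrr.
(* A condition of degree 3 is multiplied by the linear function f w x0, which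
   does not vanish at w. *)
have hw3 (F G : W -> K) : polyfun 3 F -> polyfun 3 G ->
    (forall w', alt_deco ip w' -> F w' = G w') -> F w = G w.
  move=> pF pG FG; apply: (mulIf fx0).
  apply: (hw4 (fun w => F w * f w x0) (fun w => G w * f w x0)).
  - exact: (polyfunM PF (m := 3) (n := 1)).
  - exact: (polyfunM PF (m := 3) (n := 1)).
  by move=> w' /FG ->.
split.
- move=> u x j.
  apply: (hw4 (fun w => f w (updv x i0 (centro KP ip i0 i1 (f w) u (x i0))))
    (fun w => f w (updv x j (centro KP ip i0 i1 (f w) u (x j))))).
  + exact/polyfun_fupd/vpolyfun_centro.
  + exact/polyfun_fupd/vpolyfun_centro.
  by move=> w' /XC/altc_centro; apply.
- move=> u x j.
  apply: (hw4 (fun w => f w (updv x i0 (centro_adj KP ip i0 i1 (f w) u (x i0))))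
    (fun w => f w (updv x j (centro_adj KP ip i0 i1 (f w) u (x j))))).
  + exact/polyfun_fupd/vpolyfun_centro_adj.
  + exact/polyfun_fupd/vpolyfun_centro_adj.
  by move=> w' /XC/altc_adj; apply.
- move=> z y u j.
  apply: (hw3 (fun w => d.-1%:R * f w (updv u j (gram_op KP ip i0 i1 (f w) z y (u j))))
    (fun w => derived KP ip i0 i1 (f w) z y u -
              derived KP ip i0 i1 (f w) (u j) y (updv u j z))).
  + exact/(polyfunZ PF)/polyfun_fupd/vpolyfun_gram_op.
  + by apply: (polyfunB PF); apply: polyfun_derived.
  by move=> w' /XC/altc_gram.
move=> th u z; apply: (ip_ext (ip := ip)) => y.
apply: (hw3 (fun w => ip (centro KP ip i0 i1 (f w) u z) y)
  (fun w => ip (centro_adj KP ip i0 i1 (f w) u z) y)).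
- exact: vpolyfun_centro.
- exact: vpolyfun_centro_adj.
by move=> w' /XC/altc_real ->.
Qed.

End AlternatingPolynomials.

(** * Real and complex scalars *)

Section InvariantSubspace.
Variables (K : fieldType) (V : vectType K) (A : 'End(V)) (D : {vspace V}).
Hypothesis AD : (A @: D <= D)%VS.

Definition restr_mx : 'M[K]_(\dim D) :=
  \matrix_(i, j) coord (vbasis D) j (A (vbasis D)`_i).

Definition basis_lc (r : 'rV[K]_(\dim D)) : V := \sum_i r 0 i *: (vbasis D)`_i.

Lemma basis_lc_mem r : basis_lc r \in D.
Proof.
by apply: memv_suml => i _; rewrite memvZ // vbasis_mem // mem_nth ?size_tuple.
Qed.

Lemma basis_lc_eq0 r : (basis_lc r == 0) = (r == 0).
Proof.
apply/eqP/eqP => [h|->]; last first.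
  by rewrite /basis_lc big1 // => i _; rewrite mxE scale0r.
apply/rowP => i; rewrite mxE.
by move/freeP: (basis_free (vbasisP D)) => /(_ (fun i => r 0 i) h i).
Qed.

Lemma basis_lcP a r s : basis_lc (a *: r + s) = a *: basis_lc r + basis_lc s.
Proof.
rewrite /basis_lc scaler_sumr -big_split; apply: eq_bigr => i _ /=.
by rewrite !mxE scalerDl scalerA.
Qed.

Lemma basis_lcM r : A (basis_lc r) = basis_lc (r *m restr_mx).
Proof.
rewrite /basis_lc linear_sum /=.
under [RHS]eq_bigr => j _ do rewrite mxE scaler_suml.
rewrite exchange_big /=; apply: eq_bigr => i _.
have AbD : A (vbasis D)`_i \in D.
  by rewrite (subvP AD) // memv_img // vbasis_mem // mem_nth ?size_tuple.
rewrite linearZ /= {1}(coord_vbasis AbD) scaler_sumr.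
by apply: eq_bigr => j _; rewrite scalerA mxE.
Qed.

End InvariantSubspace.

Lemma complex_eigenvector (C : numClosedFieldType) (V : vectType C) (A : 'End(V))
    (D : {vspace V}) : (A @: D <= D)%VS -> D != 0%VS ->
  exists x, [/\ x \in D, x != 0 & exists l, A x = l *: x].
Proof.
move=> AD D0; have dD : (0 < \dim D)%N by rewrite lt0n dimv_eq0.
have [l /eigenvalueP[r hr r0]] := eigenvalue_closed (restr_mx A D) dD.
exists (basis_lc r); split; rewrite ?basis_lc_mem ?basis_lc_eq0 //.
exists l; rewrite basis_lcM // hr.
by have := basis_lcP l r 0; rewrite !addr0 (eqP (_ : basis_lc 0 == 0)) ?basis_lc_eq0 ?addr0.
Qed.

(** The real and imaginary parts of a complex eigenvector for a + ib satisfy A x = a x - b y and A y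
    = b x + a y. Comparing <A x, y> with <x, A y> gives b (<x,x> + <y,y>) = 0, so b = 0 and a
    nonzero part is an eigenvector. *)
Lemma real_eigenvector (R : rcfType) (V : vectType R) (ip : {dot V for idfun})
    (A : 'End(V)) (D : {vspace V}) : (A @: D <= D)%VS -> D != 0%VS ->
  (forall x y, ip (A x) y = ip x (A y)) ->
  exists x, [/\ x \in D, x != 0 & exists l, A x = l *: x].
Proof.
move=> AD D0 sa; have dD : (0 < \dim D)%N by rewrite lt0n dimv_eq0.
pose M := restr_mx A D.
have [[a b] /eigenvalueP[r hr r0]] :=
  eigenvalue_closed (map_mx (real_complex R) M : 'M[R[i]]_(\dim D)) dD.
pose v := map_mx (@complex.Re R) r; pose w := map_mx (@complex.Im R) r.
have hv : v *m M = a *: v + (- b) *: w.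
  apply/rowP => j; have /rowP/(_ j) := hr; rewrite !mxE => /(congr1 (@complex.Re R)).
  rewrite raddf_sum /= => e; transitivity (complex.Re (Complex a b * r 0 j)).
    rewrite -e; apply: eq_bigr => i _; rewrite !mxE.
    by case: (r 0 i) => x y /=; rewrite mulr0 subr0.
  by case: (r 0 j) => x y /=; rewrite mulNr.
have hw : w *m M = b *: v + a *: w.
  apply/rowP => j; have /rowP/(_ j) := hr; rewrite !mxE => /(congr1 (@complex.Im R)).
  rewrite raddf_sum /= => e; transitivity (complex.Im (Complex a b * r 0 j)).
    rewrite -e; apply: eq_bigr => i _; rewrite !mxE.
    by case: (r 0 i) => x y /=; rewrite mulr0 add0r.
  by case: (r 0 j) => x y /=; rewrite addrC.
have lcZ c (s : 'rV_(\dim D)) : basis_lc (c *: s) = c *: basis_lc s.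
  by have := basis_lcP c s 0; rewrite addr0 (eqP (_ : basis_lc 0 == 0)) ?basis_lc_eq0 ?addr0.
pose x := basis_lc v; pose y := basis_lc w.
have Ax : A x = a *: x - b *: y.
  by rewrite /x basis_lcM // hv basis_lcP lcZ scaleNr.
have Ay : A y = b *: x + a *: y by rewrite /y basis_lcM // hw basis_lcP lcZ.
have xy0 : (x != 0) || (y != 0).
  rewrite !basis_lc_eq0 -negb_and; apply: contra r0 => /andP[/eqP v0 /eqP w0].
  apply/eqP/rowP => j; have /rowP/(_ j) := v0; have /rowP/(_ j) := w0.
  by rewrite !mxE; case: (r 0 j) => p q /= -> ->.
have b0 : b = 0.
  have pos : ip x x + ip y y != 0.
    by rewrite gt_eqF //; case/orP: xy0 => /(ip_gt0 ip) h;
      [apply: ltr_wpDr | apply: ltr_wpDl]; rewrite ?ip_ge0.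
  have := sa x y; rewrite Ax Ay ipBl !ipZl ipDr !ipZr /= => e.
  apply: (mulIf pos); rewrite mul0r.
  have -> : b * (ip x x + ip y y) =
      b * ip x x + a * ip x y - (a * ip x y - b * ip y y) by ring.
  by rewrite -e subrr.
move: Ax Ay; rewrite b0 !scale0r subr0 add0r => Ax Ay.
case/orP: xy0 => h; [exists x | exists y]; split; rewrite ?basis_lc_mem //; by exists a.
Qed.

Lemma real_scalar_field (R : realType) : @scalar_field R idfun.
Proof.
split=> // [a|a a0|V ip A D AD D0 sa].
- by rewrite -expr2 sqr_ge0.
- by exists (Num.sqrt a); rewrite -expr2 sqr_sqrtr.
- by apply: (real_eigenvector (ip := ip) AD D0 (sa _)).
Qed.

Lemma complex_scalar_field (C : numClosedFieldType) : @scalar_field C Num.conj.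
Proof.
split=> [|a|a a0|V ip A D AD D0 _].
- exact: conjCK.
- exact: mul_conjC_ge0.
- exists (sqrtC a); have h : 0 <= sqrtC a by rewrite sqrtC_ge0.
  by rewrite -[RHS]/(sqrtC a * (sqrtC a)^*) (CrealP (ger0_real h)) -expr2 sqrtCK.
- exact: complex_eigenvector.
Qed.

(** * Zero sets of homogeneous polynomials *)

Lemma homog_msize (R : nzRingType) n e (p : {mpoly R[n]}) :
  p \is e.-homog -> p != 0 -> msize p = e.+1.
Proof.
move=> /dhomogP hp p0; rewrite -mlead_deg //.
by congr _.+1; apply: hp; apply: mlead_supp.
Qed.

Lemma dhomogU (R : nzRingType) n (i : 'I_n) : 'X_i \is [in R[n], 1.-homog].
Proof. by rewrite dhomogX; apply/eqP/mdeg1. Qed.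

(** The defining set consists of all nonzero homogeneous polynomials of the allowed degrees that
    vanish on [X]; being nonzero, they have the exact degree. *)
Lemma defined_in_degreesI (R : realType) (W : Type) n (x : W -> 'I_n -> R)
    (degs : seq nat) (X : W -> Prop) :
  (forall w, (forall e p, e \in degs -> p \is e.-homog ->
     (forall w', X w' -> p.@[x w'] = 0) -> p.@[x w] = 0) -> X w) ->
  defined_in_degrees x degs X.
Proof.
move=> h; exists (fun p => [/\ (exists2 e, e \in degs & p \is e.-homog), p != 0 &
  forall w, X w -> p.@[x w] = 0]); split.
  by move=> p [[e ed pe] p0 _]; exists e => //; apply: homog_msize.
move=> w; split=> [Xw p [_ _]|hw]; first exact.
apply: h => e p ed pe pX; case: (eqVneq p 0) => [->|p0]; first by rewrite meval0.
by apply: hw; split=> //; exists e.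
Qed.

Section RealPolynomials.
Variables (R : realType) (W : vectType R).

Definition real_polyfun e (F : W -> R) :=
  exists2 p : {mpoly R[\dim {:W}]}, p \is e.-homog & forall w, p.@[rcoords w] = F w.

Lemma real_polyfunP : polynomial_functions idfun real_polyfun.
Proof.
split=> [g gl|n|n a F G [p hp pF] [q hq qG]|m n F G [p hp pF] [q hq qG]|//].
- have g0 : g 0 = 0.
    by have := gl (-1) 0 0; rewrite scaler0 addr0 mulN1r addNr.
  exists (\sum_(i < \dim {:W}) g (vbasis {:W})`_i *: 'X_i).
    by apply: rpred_sum => i _; apply: rpredZ; apply: dhomogU.
  move=> w; rewrite raddf_sum /= [in RHS](coord_vbasis (memvf w)).
  rewrite (big_morph g (id1 := 0) (op1 := +%R)) // => [|y z]; last first.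
    by have := gl 1 y z; rewrite scale1r mul1r.
  apply: eq_bigr => i _; rewrite mevalZ mevalXU /rcoords mulrC.
  by have := gl (coord (vbasis {:W}) i w) (vbasis {:W})`_i 0; rewrite g0 !addr0.
- by exists 0; [apply: rpred0 | move=> w; rewrite meval0].
- exists (a *: p + q); first by rewrite rpredD // rpredZ.
  by move=> w; rewrite mevalD mevalZ pF qG.
- by exists (p * q); [apply: dhomogM | move=> w; rewrite mevalM pF qG].
Qed.

Lemma real_varietyI e degs (X : W -> Prop) : e \in degs ->
  (forall w, (forall F, real_polyfun e F -> (forall w', X w' -> F w' = 0) -> F w = 0) ->
     X w) ->
  real_variety degs X.
Proof.
move=> ed h; apply: defined_in_degreesI => w hw; apply: h => F [p hp pF] FX.
by rewrite -pF; apply: (hw e) => // w' /FX; rewrite -pF.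
Qed.

End RealPolynomials.

Section ComplexPolynomials.
Variables (R : realType) (W : vectType R[i]).

Definition complex_polyfun e (F : W -> R[i]) :=
  exists p q : {mpoly R[\dim {:W} + \dim {:W}]},
    [/\ p \is e.-homog, q \is e.-homog &
        forall w, F w = Complex p.@[ccoords w] q.@[ccoords w]].

Lemma complex_polyfunP : polynomial_functions Num.conj complex_polyfun.
Proof.
have add_case n F G : complex_polyfun n F -> complex_polyfun n G ->
    complex_polyfun n (fun w => F w + G w).
  move=> [p [q [hp hq pq]]] [p' [q' [hp' hq' pq']]]; exists (p + p'), (q + q').
  by split=> [||w]; rewrite ?rpredD // pq pq' !mevalD.
have mul_case m n F G : complex_polyfun m F -> complex_polyfun n G ->
    complex_polyfun (m + n) (fun w => F w * G w).
  move=> [p [q [hp hq pq]]] [p' [q' [hp' hq' pq']]].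
  exists (p * p' - q * q'), (p * q' + q * p').
  split=> [||w]; rewrite ?rpredD ?rpredN ?dhomogM //.
  by rewrite pq pq' mevalB mevalD !mevalM.
have cst_case (a : R[i]) : complex_polyfun 0 (fun=> a).
  exists (complex.Re a *: 1), (complex.Im a *: 1).
  by split=> [||w]; rewrite ?dhomogZ ?dhomog1 // !mevalZ !rmorph1 !mulr1; case: a.
have zero_case n : complex_polyfun n (fun=> 0).
  by exists 0, 0; split=> [||w]; rewrite ?rpred0 // meval0.
split=> [g gl|//|n a F G hF hG|//|n F [p [q [hp hq pq]]]].
- have g0 : g 0 = 0.
    by have := gl (-1) 0 0; rewrite scaler0 addr0 mulN1r addNr.
  have coordP i : complex_polyfun 1 (coord (vbasis {:W}) i).
    exists 'X_(lshift _ i), 'X_(rshift _ i).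
    split=> [||w]; rewrite ?dhomogU // !mevalXU /ccoords.
    by rewrite (unsplitK (inl i)) (unsplitK (inr i)); case: (coord _ _ _).
  have -> : g = fun w => \sum_(i < \dim {:W}) g (vbasis {:W})`_i * coord (vbasis {:W}) i w.
    apply: funext => w; rewrite [in LHS](coord_vbasis (memvf w)).
    rewrite (big_morph g (id1 := 0) (op1 := +%R)) // => [|y z]; last first.
      by have := gl 1 y z; rewrite scale1r mul1r.
    apply: eq_bigr => i _; rewrite mulrC.
    by have := gl (coord (vbasis {:W}) i w) (vbasis {:W})`_i 0; rewrite g0 !addr0.
  elim: (index_enum _) => [|i r IH].
    by rewrite (_ : (fun _ => _) = fun=> 0) //; apply: funext => w; rewrite big_nil.
  rewrite (_ : (fun _ => _) = fun w => g (vbasis {:W})`_i * coord (vbasis {:W}) i w +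
    \sum_(j <- r) g (vbasis {:W})`_j * coord (vbasis {:W}) j w); last first.
    by apply: funext => w; rewrite big_cons.
  by apply: add_case => //; apply: (mul_case 0 1).
- by apply: add_case => //; apply: (mul_case 0).
- exists p, (- q); split=> [||w]; rewrite ?rpredN // pq mevalN //.
Qed.

(** A complex equation splits into its real and imaginary parts, two real homogeneous polynomials of
    the same degree. *)
Lemma complex_varietyI e degs (X : W -> Prop) : e \in degs ->
  (forall w, (forall F, complex_polyfun e F -> (forall w', X w' -> F w' = 0) -> F w = 0) ->
     X w) ->
  complex_variety degs X.
Proof.
move=> ed h; apply: defined_in_degreesI => w hw; apply: h => F [p [q [hp hq pq]]] FX.
have FX' w' : X w' -> p.@[ccoords w'] = 0 /\ q.@[ccoords w'] = 0.
  by move/FX; rewrite pq => -[].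
by rewrite pq (hw e p) // ?(hw e q) // => w' /FX'[].
Qed.

End ComplexPolynomials.

(** The intermediate value theorem for X^d - |a| on [0, 1 + |a|]; the boolean keeps the sign of
    [a]. *)
Lemma real_signed_root (R : rcfType) (d : nat) (a : R) : (0 < d)%N ->
  exists (e : bool) (b : R), a = (-1) ^+ e * b ^+ d.
Proof.
move=> d0; have [||b _ /rootP hb] := @poly_ivt _ ('X^d - `|a|%:P) 0 (1 + `|a|).
- by rewrite addr_ge0.
- rewrite !hornerE expr0n eqn0Ngt d0 sub0r oppr_le0 normr_ge0 /= subr_ge0.
  rewrite (le_trans (_ : `|a| <= 1 + `|a|)) ?lerDr // -{1}[1 + _]expr1.
  by rewrite ler_weXn2l // lerDl.
exists (a < 0), b; move: hb; rewrite !hornerE => /eqP.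
by rewrite subr_eq0 => /eqP ->; rewrite -realEsign ?num_real.
Qed.

Lemma complex_conj_neq_id (C : numClosedFieldType) : ~ (@Num.conj C =1 id).
Proof.
move=> /(_ 'i); rewrite conjCi => /esym/eqP.
by rewrite -addr_eq0 -mulr2n mulrn_eq0 /= (negPf (neq0Ci _)).
Qed.

Theorem theorem4 (R : realType) (d : nat) (d_ge3 : (3 <= d)%N) :
  [/\ (forall (V : vectType R) (ip : {dot V for idfun}),
         real_variety [:: 2]%N (@sym_deco R idfun d V ip)) /\
      (forall (V : vectType R[i]) (ip : {dot V for Num.conj}),
         complex_variety [:: 3]%N (@sym_deco R[i] Num.conj d V ip)),
      (forall (V : 'I_d -> vectType R) (ip : forall j, {dot (V j) for idfun}),
         real_variety [:: 2]%N (@deco R idfun d V ip)) /\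
      (forall (V : 'I_d -> vectType R[i])
              (ip : forall j, {dot (V j) for Num.conj}),
         complex_variety [:: 3]%N (@deco R[i] Num.conj d V ip)) &
      (forall (V : vectType R) (ip : {dot V for idfun}),
         real_variety [:: 2; 4]%N (@alt_deco R idfun d V ip)) /\
      (forall (V : vectType R[i]) (ip : {dot V for Num.conj}),
         complex_variety [:: 3; 4]%N (@alt_deco R[i] Num.conj d V ip))].
Proof.
have RP := real_scalar_field R; have CP := complex_scalar_field R[i].
pose i0 : 'I_d := Ordinal (ltn_trans (isT : 0 < 2)%N d_ge3).
pose i1 : 'I_d := Ordinal (ltn_trans (isT : 1 < 2)%N d_ge3).
pose i2 : 'I_d := Ordinal d_ge3.
have i10 : i1 != i0 by []; have i20 : i2 != i0 by []; have i21 : i2 != i1 by [].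
have third (j : 'I_d) : exists2 m, m != i0 & m != j.
  by case: (eqVneq i1 j) => [<-|]; [exists i2 | exists i1].
have Rroot (a : R) := real_signed_root a (leq_ltn_trans (leq0n _) (ltn_ord i0)).
have Croot (a : R[i]) : exists (e : bool) b, a = (-1) ^+ e * b ^+ d.
  exists false, (d.-root a); rewrite expr0 mul1r rootCK //.
  exact: leq_ltn_trans (ltn_ord i0).
have Cdeg : @Num.conj R[i] =1 id /\ 3 = 2 :> nat \/ ~ (@Num.conj R[i] =1 id) /\ 3 = 3 :> nat.
  by right; split=> //; apply: complex_conj_neq_id.
(* In each case a common zero of the polynomial functions of one degree vanishing on the set is
   shown to lie in it. The symmetric cases pass through ordinary decomposability and back. *)
split; split=> V ip.
- apply: (real_varietyI (e := 2)) => // w hw.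
  apply: (deco_sym_deco RP third Rroot).
  apply: (deco_polynomials RP (L := vsval) _ (real_polyfunP _) i10 _ _ hw).
  + by move=> a x y; rewrite linearP.
  + exact: sym_deco_deco.
  + by left.
- apply: (complex_varietyI (e := 3)) => // w hw.
  apply: (deco_sym_deco CP third Croot).
  apply: (deco_polynomials CP (L := vsval) _ (complex_polyfunP _) i10 _ Cdeg hw).
  + by move=> a x y; rewrite linearP.
  + exact: sym_deco_deco.
- apply: (real_varietyI (e := 2)) => // w hw.
  by apply: (deco_polynomials RP (L := id) _ (real_polyfunP _) i10 _ _ hw) => //; left.
- apply: (complex_varietyI (e := 3)) => // w hw.
  by apply: (deco_polynomials CP (L := id) _ (complex_polyfunP _) i10 _ Cdeg hw).
- apply: (real_varietyI (e := 4)) => // w.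
  exact: (alt_deco_polynomials RP i10 i20 i21 (real_polyfunP _)).
- apply: (complex_varietyI (e := 4)) => // w.
  exact: (alt_deco_polynomials CP i10 i20 i21 (complex_polyfunP _)).
Qed.
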